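(* Let $(X,\mathscr A,\mu)$ be a $\sigma$-finite measure space, let $\phi\colon X\to X$ be $\mathscr A$-measurable, and assume that the composition operator $C_\phi$ is densely defined in $L^2(\mu)$. Then: (i) $\mathcal D(C_\phi^\dag)=\{f\in L^2(\mu)\colon \mathsf E_\phi(f)\circ\phi^{-1}\in L^2(\mu)\}$ and $C_\phi^\dag f=\mathsf E_\phi(f)\circ\phi^{-1}$ for $f\in\mathcal D(C_\phi^\dag)$, (ii) $(C_\phi^* )^\dag=C_{\phi,\,\mathsf h_\phi^{-1}\circ\phi}$, the weighted composition operator induced by $\phi$ and the weight function $\frac{1}{\mathsf h_\phi\circ\phi}$.
   Context: Notation: $\mathcal D(T)$, $\mathcal N(T)$, $\mathcal R(T)$ are the domain, kernel and range of an operator $T$; $L^2(\mu)$ is the complex Hilbert space of square $\mu$-integrable $\mathscr A$-measurable complex functions on $X$. Conventions: $\frac10=\infty$, $0\cdot\infty=0$. Weighted composition operators. For an $\mathscr A$-measurable $w\colon X\to\mathbb C$ put $\mu_w(\sigma)=\int_\sigma|w|^2\,d\mu$ and $\mu_w\circ\phi^{-1}(\sigma)=\mu_w(\phi^{-1}(\sigma))$ for $\sigma\in\mathscr A$. If $\mu_w\circ\phi^{-1}$ is absolutely continuous with respect to $\mu$, then $C_{\phi,w}$ is said to be well-defined and is the operator in $L^2(\mu)$ with $\mathcal D(C_{\phi,w})=\{f\in L^2(\mu)\colon w\cdot(f\circ\phi)\in L^2(\mu)\}$, $C_{\phi,w}f=w\cdot(f\circ\phi)$ (it is closed). ''Densely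 defined'' includes being well-defined. The composition operator is $C_\phi:=C_{\phi,\mathbf 1}$, where $\mathbf 1$ is the constant function $1$ (so $\mu_{\mathbf 1}=\mu$). $\mathsf h_\phi\colon X\to[0,\infty]$ is the Radon–Nikodym derivative of $\mu\circ\phi^{-1}$: $\mu(\phi^{-1}(\Delta))=\int_\Delta\mathsf h_\phi\,d\mu$ for $\Delta\in\mathscr A$. Conditional expectation. If $C_\phi$ is densely defined, then for $f\in L^p(\mu)$, $1\le p<\infty$ (or measurable $f\ge0$), $\mathsf E_\phi(f)$ is the conditional expectation of $f$ with respect to the $\sigma$-algebra $\phi^{-1}(\mathscr A)$ and the measure $\mu$; $\mathsf E_\phi(f)\circ\phi^{-1}$ denotes the unique (up to $\mu$-null sets) $\mathscr A$-measurable function $g$ on $X$ such that $g=0$ a.e. $[\mu]$ on $\{\mathsf h_\phi=0\}$ and $\mathsf E_\phi(f)=g\circ\phi$ a.e. $[\mu]$. Reciprocal. Let $T$ be a linear operator in a Hilbert space $\mathcal H$ with $\mathcal D(T)=\mathcal N(T)\oplus(\mathcal D(T)\cap\mathcal N(T)^\perp)$ (this holds for closed $T$). The reciprocal $T^\dag$ is the unique densely defined operator with domain $\mathcal D(T^\dag)=\mathcal R(T)\oplus\mathcal R(T)^\perp$ such that $TT^\dag f=P_{\overline{\mathcal R(T)}}f$ for $f\in\mathcal D(T^\dag)$, $T^\dag Tg=P_{\mathcal N(T)^\perp}g$ for $g\in\mathcal D(T)$, and $\mathcal N(T^\dag)=\mathcal R(T)^\perp$, where $P_M$ is the orthogonal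 projection onto the closed subspace $M$. *)

(* Defs.v *)
From HB Require Import structures.
From mathcomp Require Import all_boot all_order all_algebra.
From mathcomp Require Import all_classical all_reals all_analysis.
From mathcomp Require Import measurable_realfun complex ring_quotient sesquilinear.
From mathcomp Require Import lra ring.

Set Implicit Arguments.
Unset Strict Implicit.
Unset Printing Implicit Defensive.

Import Order.TTheory GRing.Theory Num.Theory.
Import numFieldNormedType.Exports.

Local Open Scope classical_set_scope.
Local Open Scope ring_scope.
Local Open Scope complex_scope.

Section dotnorm.
Context (C : numClosedFieldType) (H : lmodType C) (form : {dot H for Num.conj}).

Lemma dot_cauchy_schwarz u v : `|form u v| ^+ 2 <= form u u * form v v.
Proof.
have [->|nz_v] := eqVneq v 0.
  by rewrite linear0r normr0 expr0n/= linear0r mulr0.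
without loss ou: u / form u v = 0.
  move=> IHo; pose a := form u v / form v v; pose u1 := u - a *: v.
  have ou: form u1 v = 0.
    by rewrite linearBl/= linearZl_LR divfK ?dnorm_eq0 ?subrr.
  rewrite (canRL (subrK _) (erefl u1)).
  rewrite linearDl /= ou add0r.
  rewrite linearZl_LR/= normrM (ger0_norm (dnorm_ge0 _ _)).
  rewrite exprMn mulrA -dnormZ hnormDd/=; last by rewrite linearZr_LR/= ou mulr0.
  have:= IHo _ ou.
  by rewrite mulrDl lerDr ou normr0 expr0n.
by rewrite ou normr0 expr0n mulr_ge0.
Qed.

Lemma dot_triangle u v :
  sqrtC (form (u + v) (u + v)) <= sqrtC (form u u) + sqrtC (form v v).
Proof.
rewrite -(@ler_pXn2r _ 2)// ?nnegrE ?addr_ge0 ?sqrtC_ge0//.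
rewrite sqrtCK sqrrD !sqrtCK addrAC dnormD lerD2l.
have -> : form u v + (form u v)^* = 'Re (form u v) *+ 2.
  by rewrite -mulr_natr ReE divfK ?pnatr_eq0.
rewrite lerMn2r/=; apply: le_trans (leif_Re_Creal _).1 _.
rewrite -sqrtCM ?nnegrE// -(sqrCK (normr_ge0 (form u v))).
by rewrite ler_sqrtC ?nnegrE ?exprn_ge0 ?mulr_ge0//; exact: dot_cauchy_schwarz.
Qed.

Lemma dot_normZ a u : sqrtC (form (a *: u) (a *: u)) = `|a| * sqrtC (form u u).
Proof. by rewrite dnormZ sqrtCM ?nnegrE ?exprn_ge0// sqrCK. Qed.

Lemma dot_norm0 u : sqrtC (form u u) = 0 -> u = 0.
Proof. by move/eqP; rewrite sqrt_dnorm_eq0 => /eqP. Qed.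

End dotnorm.

(* Complex inner product spaces. Completeness is not required: the notions
   defined on them do not use it. *)
HB.mixin Record NormedModule_isPreHilbert (C : numClosedFieldType) H
    & NormedModule C H := {
  dot : {dot H for Num.conj} ;
  dot_norm : forall u : H, dot u u = `|u| ^+ 2
}.

#[short(type="preHilbertType")]
HB.structure Definition PreHilbert (C : numClosedFieldType) :=
  {H of NormedModule_isPreHilbert C H & NormedModule C H}.

(* An operator in H, not necessarily everywhere defined, is identified with its
   graph: (u, v) \in T means u \in D(T) and T u = v. Hence equality of
   operators is equality of sets, domains included. *)
Section operators.
Context {C : numClosedFieldType} {H : preHilbertType C}.
Implicit Types (T S : set (H * H)) (M N : set H).

Definition is_operator T :=
  [/\ T (0, 0),
      forall a u v u' v', T (u, v) -> T (u', v') -> T (a *: u + u', a *: v + v')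
    & forall u v v', T (u, v) -> T (u, v') -> v = v'].

Definition opdom T : set H := [set u | exists v, T (u, v)].
Definition opran T : set H := [set v | exists u, T (u, v)].
Definition opker T : set H := [set u | T (u, 0)].

Definition orthc M : set H := [set u | forall v, M v -> dot u v = 0].

Definition addset M N : set H :=
  [set u | exists a b, [/\ M a, N b & u = a + b]].

(* v = P_M u, for a closed subspace M *)
Definition is_orthoproj M (u v : H) := M v /\ orthc M (u - v).

(* An operator when T is densely defined. *)
Definition adjoint T : set (H * H) :=
  [set p | forall u v, T (u, v) -> dot v p.1 = dot u p.2].

Definition is_reciprocal T S :=
  [/\ is_operator S, dense (opdom S),
      opdom S = addset (opran T) (orthc (opran T)) &
  [/\ forall u v, S (u, v) ->
        exists2 w, T (v, w) & is_orthoproj (closure (opran T)) u w,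
      forall u v, T (u, v) ->
        exists2 w, S (v, w) & is_orthoproj (orthc (opker T)) u w
    & opker S = orthc (opran T)]].

(* The reciprocal of T is unique (is_reciprocal_unique); when T has none, the
   default value set0 is not an operator, since its domain is empty. *)
Definition reciprocal T : set (H * H) := xget set0 [set S | is_reciprocal T S].

Lemma is_orthoproj_orthc_unique M u v v' :
  is_orthoproj (orthc M) u v -> is_orthoproj (orthc M) u v' -> v = v'.
Proof.
move=> [Mv uv] [Mv' uv'].
have Mvv : orthc M (v - v').
  by move=> w Mw; rewrite linearBl/= Mv// Mv'// subrr.
have := uv' _ Mvv; have := uv _ Mvv; rewrite !linearBl/= => h h'.
apply/eqP; rewrite -subr_eq0 -(dnorm_eq0 dot) linearBl/= -(subrr (0 : C)).
by rewrite -{1}h' -h; apply/eqP; ring.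
Qed.

Lemma is_reciprocal_sub T S S' :
  is_reciprocal T S -> is_reciprocal T S' -> S `<=` S'.
Proof.
move=> [[_ addS funS] _ domS [_ TS kerS]] [[_ addS' _] _ _ [_ TS' kerS']].
move=> [u v] Suv; have : opdom S u by exists v.
rewrite domS => -[a [b [[g Tga] rb uab]]].
have [w Saw gw] := TS _ _ Tga; have [w' S'aw gw'] := TS' _ _ Tga.
have ww := is_orthoproj_orthc_unique gw gw'; rewrite -{}ww in S'aw.
have Sb : S (b, 0) by move: rb; rewrite -kerS.
have S'b : S' (b, 0) by move: rb; rewrite -kerS'.
have := addS 1 _ _ _ _ Saw Sb; have := addS' 1 _ _ _ _ S'aw S'b.
by rewrite !scale1r addr0 -uab => S'uw /(funS _ _ _ Suv) ->.
Qed.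

Lemma is_reciprocal_unique T S S' :
  is_reciprocal T S -> is_reciprocal T S' -> S = S'.
Proof.
move=> TS TS'; apply/seteqP; split; first exact: is_reciprocal_sub TS TS'.
exact: is_reciprocal_sub TS' TS.
Qed.

Lemma reciprocalE T S : is_reciprocal T S -> reciprocal T = S.
Proof.
move=> TS; rewrite /reciprocal.
by case: xgetP => [S' _ TS'|/(_ S)//]; exact: is_reciprocal_unique TS' TS.
Qed.

End operators.

Local Notation cRe := (@complex.Re _).
Local Notation cIm := (@complex.Im _).

Lemma cReM (R : realType) (a b : R[i]) : cRe (a * b) = cRe a * cRe b - cIm a * cIm b.
Proof. by case: a b => [a1 a2] [b1 b2]. Qed.

Lemma cImM (R : realType) (a b : R[i]) : cIm (a * b) = cRe a * cIm b + cIm a * cRe b.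
Proof. by case: a b => [a1 a2] [b1 b2]. Qed.

Lemma sqr_normcE (R : realType) (z : R[i]) :
  Normc.normc z ^+ 2 = cRe z ^+ 2 + cIm z ^+ 2.
Proof. by case: z => a b /=; rewrite sqr_sqrtr ?addr_ge0 ?sqr_ge0. Qed.

Section complex_functions.
Context d (X : measurableType d) (R : realType).
Variable mu : {measure set X -> \bar R}.

(* Borel measurability for the usual topology of the complex plane. *)
Definition cmeasurable (f : X -> R[i]) :=
  measurable_fun setT (cRe \o f) /\ measurable_fun setT (cIm \o f).

Definition cintegrable (D : set X) (f : X -> R[i]) :=
  mu.-integrable D (EFin \o (cRe \o f)) /\
  mu.-integrable D (EFin \o (cIm \o f)).

Definition cintegral (D : set X) (f : X -> R[i]) : R[i] :=
  (\int[mu]_(x in D) cRe (f x)) +i* (\int[mu]_(x in D) cIm (f x)).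

Definition square_integrable (f : X -> R[i]) :=
  cmeasurable f /\ (\int[mu]_x (Normc.normc (f x) ^+ 2)%:E < +oo)%E.

Let rsq (a : X -> R) := measurable_fun setT a /\
  mu.-integrable setT (EFin \o (fun x => a x ^+ 2)).

Let rsq_mul a b : rsq a -> rsq b -> mu.-integrable setT (EFin \o (a \* b)).
Proof.
move=> [ma ia] [mb ib].
apply: (le_integrable measurableT _ _ (integrableD measurableT ia ib)).
  by apply/measurable_EFinP; exact: measurable_funM.
move=> x _ /=; rewrite lee_fin normrM.
rewrite [leRHS]ger0_norm ?addr_ge0 ?sqr_ge0//.
rewrite -(real_normK (num_real (a x))) -(real_normK (num_real (b x))).
have := normr_ge0 (a x); have := normr_ge0 (b x).
set u := `|a x|; set v := `|b x| => v0 u0; have := sqr_ge0 (u - v); nra.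
Qed.

Let rsqD a b : rsq a -> rsq b -> rsq (a \+ b).
Proof.
move=> sa sb; split; first by apply: measurable_funD; [exact: sa.1|exact: sb.1].
have -> : EFin \o (fun x => (a \+ b) x ^+ 2) = ((EFin \o (fun x => a x ^+ 2)%R) \+
    ((EFin \o (fun x => b x ^+ 2)%R) \+ ((EFin \o (a \* b)%R) \+ (EFin \o (a \* b)%R))))%E.
  by apply/funext => x /=; congr EFin; rewrite sqrrD mulr2n; ring.
by do !apply: integrableD => //; rewrite ?sa.2 ?sb.2//; exact: rsq_mul.
Qed.

Let rsqZ k a : rsq a -> rsq (fun x => k * a x).
Proof.
move=> sa; split; first by apply: measurable_funM => //; exact: sa.1.
have -> : EFin \o (fun x => (k * a x) ^+ 2) =
    (fun x => (k ^+ 2)%:E * (EFin \o (fun x => a x ^+ 2)%R) x)%E.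
  by apply/funext => x /=; rewrite exprMn.
by apply: integrableZl => //; exact: sa.2.
Qed.

Let ge0_sq (a : X -> R) x : setT x -> (0 <= (EFin \o (fun x => a x ^+ 2)%R) x)%E.
Proof. by rewrite /= lee_fin sqr_ge0. Qed.

Let msq (a : X -> R) : measurable_fun setT a ->
  measurable_fun setT (EFin \o (fun x => a x ^+ 2)).
Proof. by move=> ma; apply/measurable_EFinP; exact: measurable_funX. Qed.

Let sqintP f : square_integrable f <-> rsq (cRe \o f) /\ rsq (cIm \o f).
Proof.
have rsqP a : measurable_fun setT a ->
    rsq a <-> (\int[mu]_x (EFin \o (fun x => a x ^+ 2)%R) x < +oo)%E.
  move=> ma; have E : (\int[mu]_x (EFin \o (fun x => a x ^+ 2)%R) x =
      \int[mu]_x `|(EFin \o (fun x => a x ^+ 2)%R) x|)%E.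
    by apply: eq_integral => x _; rewrite gee0_abs ?ge0_sq.
  split=> [[_ /integrableP[_]]|h]; first by rewrite -E.
  by split => //; apply/integrableP; split; [exact: msq|rewrite -E].
have fE : cmeasurable f -> (\int[mu]_x (Normc.normc (f x) ^+ 2)%:E =
    \int[mu]_x (EFin \o (fun x => (cRe \o f) x ^+ 2)%R) x +
    \int[mu]_x (EFin \o (fun x => (cIm \o f) x ^+ 2)%R) x)%E.
  move=> [mr mi].
  rewrite -ge0_integralD//; [|exact: ge0_sq|exact: msq|exact: ge0_sq|exact: msq].
  by apply: eq_integral => x _ /=; rewrite sqr_normcE.
split=> [[[mr mi]]|[fr fi]].
  rewrite fE// => h; split; apply/rsqP => //; apply: le_lt_trans h.
    by rewrite leeDl// integral_ge0//; exact: ge0_sq.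
  by rewrite leeDr// integral_ge0//; exact: ge0_sq.
have mf : cmeasurable f by split; [exact: fr.1|exact: fi.1].
split=> //; rewrite fE//; apply: lte_add_pinfty; [apply/(rsqP _ mf.1)|apply/(rsqP _ mf.2)] => //.
Qed.

Lemma square_integrableD f g :
  square_integrable f -> square_integrable g -> square_integrable (f + g).
Proof.
move=> /sqintP[fr fi] /sqintP[gr gi]; apply/sqintP; split.
  rewrite (_ : _ \o _ = (cRe \o f) \+ (cRe \o g)); first exact: rsqD.
  by apply/funext => x /=; exact: raddfD.
rewrite (_ : _ \o _ = (cIm \o f) \+ (cIm \o g)); first exact: rsqD.
by apply/funext => x /=; exact: raddfD.
Qed.

Lemma square_integrableZ a f :
  square_integrable f -> square_integrable (a *: f).
Proof.
move=> /sqintP[fr fi]; apply/sqintP; split.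
  rewrite (_ : _ \o _ = (fun x => cRe a * (cRe \o f) x) \+
     (fun x => - cIm a * (cIm \o f) x)).
    by apply: rsqD; exact: rsqZ.
  by apply/funext => x; rewrite /= cReM mulNr.
rewrite (_ : _ \o _ = (fun x => cRe a * (cIm \o f) x) \+
   (fun x => cIm a * (cRe \o f) x)).
  by apply: rsqD; exact: rsqZ.
by apply/funext => x; rewrite /= cImM.
Qed.

Lemma square_integrable0 : square_integrable 0.
Proof.
split; first by split; exact: measurable_cst.
under eq_integral => x _ do rewrite Normc.normc0 expr0n/=.
by rewrite integral0.
Qed.

Lemma cintegrable_dot f g : square_integrable f -> square_integrable g ->
  cintegrable setT (fun x => f x * (g x)^*).
Proof.
move=> /sqintP[fr fi] /sqintP[gr gi].
have h a : cRe (a^*) = cRe a :> R by case: a.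
have h' a : cIm (a^*) = - cIm a :> R by case: a.
split.
  rewrite (_ : EFin \o _ =
     (EFin \o ((cRe \o f) \* (cRe \o g))%R) \+
     (EFin \o ((cIm \o f) \* (cIm \o g))%R))%E.
    by apply: integrableD => //; exact: rsq_mul.
  by apply/funext => x; rewrite /= cReM h h' mulrN opprK.
rewrite (_ : EFin \o _ =
     (EFin \o ((cIm \o f) \* (cRe \o g))%R) \-
     (EFin \o ((cRe \o f) \* (cIm \o g))%R))%E.
  by apply: integrableB => //; exact: rsq_mul.
by apply/funext => x; rewrite /= cImM h h' mulrN addrC.
Qed.

Lemma cintegralD D f g : measurable D -> cintegrable D f -> cintegrable D g ->
  cintegral D (fun x => f x + g x) = cintegral D f + cintegral D g.
Proof.
move=> mD [fr fi] [gr gi]; rewrite /cintegral.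
have -> : (fun x => cRe (f x + g x)) = (fun x => cRe (f x) + cRe (g x)).
  by apply/funext => x; exact: raddfD.
have -> : (fun x => cIm (f x + g x)) = (fun x => cIm (f x) + cIm (g x)).
  by apply/funext => x; exact: raddfD.
by rewrite !RintegralD.
Qed.

Lemma cintegralZ D a f : measurable D -> cintegrable D f ->
  cintegral D (fun x => a * f x) = a * cintegral D f.
Proof.
move=> mD [fr fi]; rewrite /cintegral.
under eq_Rintegral => x _ do rewrite cReM.
under [X in _ +i* X]eq_Rintegral => x _ do rewrite cImM.
have Zr k : mu.-integrable D (EFin \o (fun x => k * cRe (f x))).
  exact: (integrableZl mD k fr).
have Zi k : mu.-integrable D (EFin \o (fun x => k * cIm (f x))).
  exact: (integrableZl mD k fi).
rewrite RintegralB// RintegralD//.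
rewrite !RintegralZl//.
by case: a.
Qed.

Lemma cintegral_conj D f : measurable D -> cintegrable D f ->
  cintegral D (fun x => (f x)^*) = (cintegral D f)^*.
Proof.
move=> mD [fr fi]; rewrite /cintegral /=; congr (_ +i* _).
  by apply: eq_Rintegral => x _; case: (f x).
rewrite -mulN1r -RintegralZl//.
by apply: eq_Rintegral => x _; case: (f x) => a b /=; rewrite mulN1r.
Qed.

Lemma ae_eq_cintegral D f g : measurable D -> cmeasurable f -> cmeasurable g ->
  f = g %[ae mu in D] -> cintegral D f = cintegral D g.
Proof.
move=> mD [fr fi] [gr gi] fg; rewrite /cintegral /Rintegral; congr (fine _ +i* fine _);
  apply: ae_eq_integral => //.
- by apply/measurable_EFinP; exact: measurable_funTS fr.
- by apply/measurable_EFinP; exact: measurable_funTS gr.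
- by apply: filterS fg => x /[apply] /= ->.
- by apply/measurable_EFinP; exact: measurable_funTS fi.
- by apply/measurable_EFinP; exact: measurable_funTS gi.
- by apply: filterS fg => x /[apply] /= ->.
Qed.

Lemma cmeasurableM f g : cmeasurable f -> cmeasurable g ->
  cmeasurable (fun x => f x * g x).
Proof.
move=> [fr fi] [gr gi]; split.
  rewrite (_ : _ \o _ = ((cRe \o f) \* (cRe \o g)) \- ((cIm \o f) \* (cIm \o g))).
    by apply: measurable_funB; exact: measurable_funM.
  by apply/funext => x; exact: cReM.
rewrite (_ : _ \o _ = ((cRe \o f) \* (cIm \o g)) \+ ((cIm \o f) \* (cRe \o g))).
  by apply: measurable_funD; exact: measurable_funM.
by apply/funext => x; exact: cImM.
Qed.

Lemma cmeasurableD f g : cmeasurable f -> cmeasurable g ->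
  cmeasurable (fun x => f x + g x).
Proof.
move=> [fr fi] [gr gi]; split.
  rewrite (_ : _ \o _ = (cRe \o f) \+ (cRe \o g)); first exact: measurable_funD.
  by apply/funext => x; exact: raddfD.
rewrite (_ : _ \o _ = (cIm \o f) \+ (cIm \o g)); first exact: measurable_funD.
by apply/funext => x; exact: raddfD.
Qed.

Lemma cmeasurable_conj f : cmeasurable f -> cmeasurable (fun x => (f x)^*).
Proof.
move=> [fr fi]; split.
  by rewrite (_ : _ \o _ = cRe \o f)//; apply/funext => x /=; case: (f x).
rewrite (_ : _ \o _ = (fun x => - (cIm \o f) x)); first exact: measurableT_comp.
by apply/funext => x /=; case: (f x).
Qed.

Lemma measurable_sqr_normc f : cmeasurable f ->
  measurable_fun setT (fun x => Normc.normc (f x) ^+ 2).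
Proof.
move=> [fr fi].
rewrite (_ : (fun _ => _) = (fun x => (cRe \o f) x ^+ 2 + (cIm \o f) x ^+ 2)).
  by apply: measurable_funD; exact: measurable_funX.
by apply/funext => x; exact: sqr_normcE.
Qed.

End complex_functions.

Section L2fun.
Context d (X : measurableType d) (R : realType).
Variable mu : {measure set X -> \bar R}.

Definition sqint : {pred X -> R[i]} := [pred f | `[< square_integrable mu f >]].

Lemma sqint_submod_closed : submod_closed sqint.
Proof.
split; first by apply/asboolP; exact: square_integrable0.
move=> a f g /asboolP sf /asboolP sg; apply/asboolP.
by apply: square_integrableD => //; exact: square_integrableZ.
Qed.

HB.instance Definition _ :=
  GRing.isSubmodClosed.Build R[i] (X -> R[i]) sqint sqint_submod_closed.

Record L2fun := MkL2fun { L2fun_val :> X -> R[i]; _ : L2fun_val \in sqint }.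

HB.instance Definition _ := [isSub for L2fun_val].
HB.instance Definition _ := [Choice of L2fun by <:].
HB.instance Definition _ := [SubChoice_isSubLmodule of L2fun by <:].

Definition ae_null : {pred L2fun} :=
  [pred f : L2fun | `[< (f : X -> R[i]) = cst 0 %[ae mu] >]].

Lemma ae_null_submod_closed : submod_closed ae_null.
Proof.
split; first by apply/asboolP; exact: ae_eq_refl.
move=> a f g /asboolP f0 /asboolP g0; apply/asboolP.
apply: filterS2 f0 g0 => x /(_ I) fx /(_ I) gx _; rewrite {}/cst in fx gx *.
by rewrite -[LHS]/(a * f x + g x) fx gx mulr0 addr0.
Qed.

HB.instance Definition _ :=
  GRing.isSubmodClosed.Build R[i] L2fun ae_null ae_null_submod_closed.

Definition L2 := Quotient.quot ae_null.
HB.instance Definition _ := Choice.on L2.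
HB.instance Definition _ := GRing.Zmodule.on L2.
HB.instance Definition _ := ZmodQuotient.on L2.

(* A chosen representative of the class F; L2_eqP: F = G iff F and G agree a.e. *)
Definition L2_fun (F : L2) : X -> R[i] := L2fun_val (repr F).
Coercion L2_fun : L2 >-> Funclass.

Local Open Scope quotient_scope.
Let cls (f : L2fun) : L2 := \pi_L2 f.

Lemma cls_eq (f g : L2fun) : cls f = cls g <-> (f : X -> R[i]) = g %[ae mu].
Proof.
split=> [/eqP|fg].
  rewrite /cls -Quotient.idealrBE => /asboolP; apply: filterS => x /(_ I) /= h _.
  by apply/eqP; rewrite -subr_eq0; apply/eqP.
apply/eqP; rewrite /cls -Quotient.idealrBE; apply/asboolP; apply: filterS fg => x /(_ I) h _.
by rewrite -[LHS]/(f x - g x) h subrr.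
Qed.

Lemma cls_repr (f : L2fun) : (cls f : X -> R[i]) = f %[ae mu].
Proof. by apply/cls_eq; rewrite /cls reprK. Qed.

Lemma clsD (f g : L2fun) : cls (f + g) = cls f + cls g.
Proof. exact: raddfD. Qed.

Lemma clsK (F : L2) : cls (repr F) = F.
Proof. exact: reprK. Qed.

Lemma L2D (F G : L2) : (F + G : L2) = (fun x => F x + G x) %[ae mu].
Proof.
have e : cls (repr F + repr G) = F + G by rewrite clsD !clsK.
by apply: filterS (cls_repr (repr F + repr G)) => x /(_ I) h _; rewrite -e h.
Qed.

Definition L2scale (a : R[i]) (F : L2) : L2 := cls (a *: repr F).

Lemma cls_scale a f : cls (a *: f) = L2scale a (cls f).
Proof.
apply/cls_eq; apply: filterS (cls_repr f) => x /(_ I) h _.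
by rewrite -[LHS]/(a * f x) -h.
Qed.

Lemma L2scaleA a b F : L2scale a (L2scale b F) = L2scale (a * b) F.
Proof. by rewrite -[F]clsK -!cls_scale scalerA. Qed.

Lemma L2scale1 : left_id 1 L2scale.
Proof. by move=> F; rewrite -[F]clsK -!cls_scale scale1r. Qed.

Lemma L2scaleDr : right_distributive L2scale +%R.
Proof.
by move=> a F G; rewrite -[F]clsK -[G]clsK -clsD -!cls_scale scalerDr clsD.
Qed.

Lemma L2scaleDl F : {morph L2scale^~ F : a b / a + b}.
Proof. by move=> a b; rewrite -[F]clsK -!cls_scale scalerDl clsD. Qed.

HB.instance Definition _ := GRing.Zmodule_isLmodule.Build R[i] L2
  L2scaleA L2scale1 L2scaleDr L2scaleDl.

Lemma L2Z a (F : L2) : (a *: F : L2) = (fun x => a * F x) %[ae mu].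
Proof. by apply: filterS (cls_repr (a *: repr F)) => x /(_ I) h _; exact: h. Qed.

Lemma L2_square_integrable (F : L2) : square_integrable mu F.
Proof. by apply/asboolP; rewrite /L2_fun; case: (repr F). Qed.

Lemma L2_eqP (F G : L2) : F = G <-> (F : X -> R[i]) = G %[ae mu].
Proof. by rewrite -{1}[F]clsK -{1}[G]clsK cls_eq. Qed.

Definition L2dot (F G : L2) : R[i] := cintegral mu setT (fun x => F x * (G x)^*).

Lemma cmeasurable_L2 (F : L2) : cmeasurable F.
Proof. by have [] := L2_square_integrable F. Qed.

Let mdot (F G : L2) : cmeasurable (fun x => F x * (G x)^*).
Proof. by apply: cmeasurableM; [|apply: cmeasurable_conj]; exact: cmeasurable_L2. Qed.

Let idot (F G : L2) : cintegrable mu setT (fun x => F x * (G x)^*).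
Proof. by apply: cintegrable_dot; exact: L2_square_integrable. Qed.

Lemma L2dotDl F F' G : L2dot (F + F') G = L2dot F G + L2dot F' G.
Proof.
rewrite /L2dot -cintegralD//; apply: ae_eq_cintegral => //.
  by apply: cmeasurableD; exact: mdot.
by apply: filterS (L2D F F') => x /(_ I) h _; rewrite h mulrDl.
Qed.

Lemma L2dotZl a F G : L2dot (a *: F) G = a * L2dot F G.
Proof.
rewrite /L2dot -cintegralZ//; apply: ae_eq_cintegral => //.
  by apply: cmeasurableM; [split; exact: measurable_cst|exact: mdot].
by apply: filterS (L2Z a F) => x /(_ I) h _; rewrite h mulrA.
Qed.

Lemma L2dotC F G : L2dot F G = (L2dot G F)^*.
Proof.
rewrite /L2dot -cintegral_conj//; congr (cintegral _ _ _).
by apply/funext => x; rewrite rmorphM/= conjcK mulrC.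
Qed.

Lemma L2dot_gt0 (F : L2) : F != 0 -> 0 < L2dot F F.
Proof.
move=> F0.
have E : L2dot F F = (\int[mu]_x (Normc.normc (F x) ^+ 2))%:C.
  rewrite /L2dot /cintegral; congr (_ +i* _).
    apply: eq_Rintegral => x _; rewrite sqr_normcE.
    by case: (F x) => a b; rewrite cReM /= mulrN opprK.
  rewrite (_ : (fun _ => _) = cst 0) ?Rintegral_cst ?mul0r//.
  by apply/funext => x; case: (F x) => a b; rewrite cImM /= mulrN mulrC addNr.
rewrite E ltcR lt_def Rintegral_ge0 ?andbT; last by move=> x _; exact: sqr_ge0.
apply: contra F0 => /eqP I0; apply/eqP/L2_eqP.
have [mF Foo] := L2_square_integrable F.
have mF2 := measurable_sqr_normc mF.
have I0' : (\int[mu]_x `|(Normc.normc (F x) ^+ 2)%:E| = 0)%E.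
  under eq_integral => x _ do rewrite gee0_abs ?lee_fin ?sqr_ge0//.
  rewrite -[LHS]fineK; first by rewrite -/(Rintegral _ _ _) I0.
  by rewrite ge0_fin_numE//; apply: integral_ge0 => x _; rewrite lee_fin sqr_ge0.
have z : (0 : L2) = (cst 0 : X -> R[i]) %[ae mu].
  have e : cls 0 = 0 by exact: raddf0.
  by apply: filterS (cls_repr 0) => x /(_ I) h _; rewrite -e h.
move/measurable_EFinP/(ae_eq_integral_abs mu measurableT) : mF2 => [+ _].
move=> /(_ I0'); apply: filterS2 z => x /(_ I) h0 /(_ I) [] /eqP.
by rewrite sqrf_eq0 => /eqP /Normc.eq0_normc h _; rewrite h0 h.
Qed.

Let L2dotDr F G G' : L2dot F (G + G') = L2dot F G + L2dot F G'.
Proof. by rewrite !(L2dotC F) L2dotDl rmorphD. Qed.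

Let L2dotZr a F G : L2dot F (a *: G) = a^* * L2dot F G.
Proof. by rewrite !(L2dotC F) L2dotZl rmorphM. Qed.

Lemma L2dot_bilinear :
  bilinear_for ( *%R : GRing.Scale.law _ _) (Num.conj \; *%R : GRing.Scale.law _ _) L2dot.
Proof.
split=> [G a F F'|F a G G'] /=; first by rewrite L2dotDl L2dotZl.
by rewrite L2dotDr L2dotZr.
Qed.

HB.instance Definition _ := bilinear_isBilinear.Build R[i] L2 L2 R[i]
  ( *%R : GRing.Scale.law _ _) (Num.conj \; *%R : GRing.Scale.law _ _) L2dot L2dot_bilinear.

Lemma L2dot_hermitian F G : L2dot F G = (-1) ^+ false * Num.conj (L2dot G F).
Proof. by rewrite expr0 mul1r; exact: L2dotC. Qed.

HB.instance Definition _ := isHermitianSesquilinear.Build R[i] L2 false Num.conj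
  L2dot L2dot_hermitian.

HB.instance Definition _ := isDotProduct.Build R[i] L2 L2dot L2dot_gt0.

HB.instance Definition _ := Lmodule_isNormed.Build R[i] L2
  (@dot_triangle _ _ L2dot) (@dot_normZ _ _ L2dot) (@dot_norm0 _ _ L2dot).

Lemma L2_dot_norm (F : L2) : L2dot F F = `|F| ^+ 2.
Proof. by rewrite sqrtCK. Qed.

HB.instance Definition _ :=
  NormedModule_isPreHilbert.Build R[i] L2 L2_dot_norm.

End L2fun.

Section weighted_composition.
Context d (X : measurableType d) (R : realType).
Variables (mu : {measure set X -> \bar R}) (phi : X -> X).

(* mu_w \o phi^-1 is absolutely continuous with respect to mu. *)
Definition wcomp_well_defined (w : X -> R[i]) :=
  (fun A => \int[mu]_(x in phi @^-1` A) (Normc.normc (w x) ^+ 2)%:E)%E `<< mu.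

(* C_{phi,w}; the choice of the representative of p.1 is immaterial when
   wcomp_well_defined w holds. *)
Definition wcomp (w : X -> R[i]) : set (L2 mu * L2 mu) :=
  [set p : L2 mu * L2 mu |
    (p.2 : X -> R[i]) = (fun x => w x * p.1 (phi x)) %[ae mu]].

Definition wcomp_densely_defined (w : X -> R[i]) :=
  wcomp_well_defined w /\ dense (opdom (wcomp w)).

Definition comp_op : set (L2 mu * L2 mu) := wcomp (cst 1).

Definition is_RN_derivative (h : X -> \bar R) :=
  [/\ measurable_fun setT h, forall x, (0 <= h x)%E
    & forall A, measurable A -> mu (phi @^-1` A) = \int[mu]_(x in A) h x]%E.

(* e is a version of the conditional expectation of f with respect to the
   sigma-algebra of the sets phi^-1(A). The equality of integrals is required on
   those of finite measure, over which every square-integrable f is integrable;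
   this determines e up to a null set if mu is sigma-finite on that
   sigma-algebra. *)
Definition is_cond_exp (f e : X -> R[i]) :=
  cmeasurable (e : g_sigma_algebra_preimageType phi -> R[i]) /\
  forall A, measurable A -> (mu (phi @^-1` A) < +oo)%E ->
    cintegrable mu (phi @^-1` A) e /\
    cintegral mu (phi @^-1` A) e = cintegral mu (phi @^-1` A) f.

(* g is a version of E_phi(f) \o phi^-1. *)
Definition is_cond_exp_pullback (h : X -> \bar R) (f g : X -> R[i]) :=
  [/\ cmeasurable g, {ae mu, forall x, h x = 0%E -> g x = 0}
    & exists2 e, is_cond_exp f e & e = g \o phi %[ae mu]].

(* 1 / (h \o phi); fine sends +oo to 0, so the values of h \o phi in {0, +oo}
   (a null set when h is as above and C_phi is densely defined) give weight 0. *)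
Definition inv_weight (h : X -> \bar R) : X -> R[i] :=
  fun x => (fine (h (phi x))^-1%E)%:C.

End weighted_composition.

Arguments wcomp {d X R} mu phi w _.
Arguments comp_op {d X R} mu phi _.

(* Main.v *)
From HB Require Import structures.
Require Import Defs.
From mathcomp Require Import all_boot all_order all_algebra.
From mathcomp Require Import all_classical all_reals all_analysis.
From mathcomp Require Import measurable_realfun complex sesquilinear lra ring.

(** Let nu be the image of mu under phi; its density with respect to mu is h,
    which is finite a.e. because C_phi is densely defined. The identity
      int (K o phi) dmu = int K dnu = int K h dmu
    says that K |-> K o phi is isometric from L2(nu) to L2(mu). Everything rests
    on the orthogonal decomposition that this isometry induces
    ([L2_projection]): every F in L2(mu) is G + (F - G), where G = g o phi and
    F - G is orthogonal to each K o phi in L2(mu). For F >= 0 the function g is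
    the Radon-Nikodym derivative with respect to nu of the image under phi of
    the measure F mu, which replaces an appeal to the completeness of L2(mu); it
    is in L2(nu) because pairing F with truncations of g o phi bounds them by F.
    Testing against K = 1_A shows that G is a conditional expectation of F, and
    conditional expectations are unique, so g is E_phi(F) o phi^-1 up to its
    values on the set where h = 0, which phi avoids a.e.
    ([cond_exp_pullbackP]).

    Write T for C_phi. Truncating g to sets where it is small makes G a limit of
    elements of the range of T ([closure_ran_comp]); hence G is the projection
    of F on the closure of that range.

    For (i), let S F be the function g for those F such that g, cut off to 0
    where h = 0, is in L2(mu). If F is in the domain of S, then F = T(S F) + (F - T(S F)) is a decomposition in
    R(T) + R(T)^perp; conversely S maps T u to the part of u that lives on the
    set where h is not 0, which is the projection of u on N(T)^perp, and S
    vanishes exactly on R(T)^perp. These are the properties that define the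
    reciprocal ([pullback_reciprocal]).

    For (ii), let W be the operator u |-> (u / h) o phi. The change of variables
    above gives T^* F = h g ([adjoint_comp_projection]), and so W undoes T^* up
    to projections: W (T^* F) = g o phi, the projection of F on N(T^* )^perp, and
    T^* (W u) is the part of u on the set where h is not 0. As W is densely
    defined, R(T^* )^perp consists of the functions that vanish where h is not
    0, which is the kernel of W ([inv_weight_reciprocal]). *)

Set Implicit Arguments.
Unset Strict Implicit.
Unset Printing Implicit Defensive.

Import Order.TTheory GRing.Theory Num.Theory.
Import numFieldNormedType.Exports.

Local Open Scope classical_set_scope.
Local Open Scope ring_scope.
Local Open Scope complex_scope.

Local Notation cRe := (@complex.Re _).
Local Notation cIm := (@complex.Im _).
Local Notation normc := Normc.normc.

(** * Inner product spaces *)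

Section hilbert.
Context {C : numClosedFieldType} {H : preHilbertType C}.
Implicit Types (M N : set H) (u v w : H).

Lemma dot_eq0C u v : dot u v = 0 -> dot v u = 0.
Proof. by move=> uv; rewrite hermC/= uv rmorph0 mulr0. Qed.

Lemma normr_dot_le u v : `|dot u v| <= `|u| * `|v|.
Proof.
rewrite -(@ler_pXn2r _ 2)// ?nnegrE ?mulr_ge0// exprMn -!dot_norm.
exact: dot_cauchy_schwarz.
Qed.

Lemma dot0_eq0 u : dot u u = 0 -> u = 0.
Proof. by move/eqP; rewrite dnorm_eq0 => /eqP. Qed.

Lemma closureP M u :
  closure M u <-> forall e : C, 0 < e -> exists2 v, M v & `|u - v| < e.
Proof.
split=> [uM e e0|uM B].
  by have [v [Mv uv]] := uM _ (nbhsx_ballx u e e0); exists v => //; rewrite -ball_normE in uv.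
move=> /nbhs_ballP[e e0 eB]; have [v Mv uv] := uM e e0.
by exists v; split => //; apply: eB; rewrite -ball_normE.
Qed.

Lemma orthc_closure M : orthc (closure M) = orthc M.
Proof.
apply/seteqP; split=> u uM v Mv; first by apply: uM; exact: subset_closure.
apply/eqP; rewrite -normr_le0; apply/ler_addgt0Pr => e e0; rewrite add0r.
have u1 : 0 < `|u| + 1 by rewrite ltr_wpDl.
have [w Mw vw] := (closureP _ _).1 Mv (e / (`|u| + 1)) (divr_gt0 e0 u1).
have -> : dot u v = dot u (v - w) by rewrite linearBr/= (uM _ Mw) subr0.
apply: le_trans (normr_dot_le _ _) _.
apply: (@le_trans _ _ ((`|u| + 1) * `|v - w|)).
  by apply: ler_wpM2r => //; rewrite lerDl.
by rewrite mulrC -ler_pdivlMr// ltW.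
Qed.

Lemma dense_closureP M : dense M <-> forall u, closure M u.
Proof.
split=> [dM u B|cM O [u Ou] oO].
  rewrite nbhsE; case=> O [oO Ou] OB.
  case: (dM O (ex_intro _ u Ou) oO) => v [Ov Mv].
  by exists v; split => //; exact: OB.
by case: (cM u O (open_nbhs_nbhs (conj oO Ou))) => v [Mv Ov]; exists v.
Qed.

Lemma orthc_dense M u : dense M -> orthc M u -> u = 0.
Proof.
move=> dM uM; apply: dot0_eq0.
suff : orthc (closure M) u by apply; exact: ((dense_closureP M).1 dM).
by rewrite orthc_closure.
Qed.

Lemma closure_translate M N u v :
  closure M u -> (forall w, M w -> N (w + v)) -> closure N (u + v).
Proof.
move=> /closureP uM MN; apply/closureP => e /uM[w Mw uw].
by exists (w + v); [exact: MN|rewrite opprD addrACA subrr addr0].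
Qed.

End hilbert.

(** * Weights and image measures *)

(** A weight t makes every function dominated by a multiple of t integrable, so
    truncating to the sets where b <= n t brings an arbitrary function b under
    control while these sets still exhaust the space. It is the sum of the
    indicators of a cover by sets of finite measure, each one scaled down to
    integral at most 2^-(n+1). *)
Lemma sigma_finite_weight d (X : measurableType d) (R : realType)
    (m : {measure set X -> \bar R}) : sigma_finite setT m ->
  exists t : X -> R, [/\ measurable_fun setT t, forall x, 0 < t x <= 1
    & (\int[m]_x (t x)%:E < +oo)%E].
Proof.
case=> F FT mF.
pose c n : R := (1 / (2 ^ n.+1)%:R) / (1 + fine (m (F n))).
have c0 n : 0 < c n.
  by rewrite divr_gt0 ?divr_gt0 ?ltr_wpDr ?fine_ge0// ltr0n expn_gt0.
have cle n : c n <= 1 / (2 ^ n.+1)%:R.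
  by rewrite /c ler_pdivrMr ?ltr_wpDr ?fine_ge0// ler_peMr ?divr_ge0// lerDl fine_ge0.
have cm n : ((c n)%:E * m (F n) <= (1 / (2 ^ n.+1)%:R)%:E)%E.
  have [_ mFoo] := mF n.
  rewrite -(@fineK _ (m (F n))) ?ge0_fin_numE// -EFinM lee_fin /c.
  have /fine_ge0 : (0 <= m (F n))%E by [].
  move: (fine _) => a a0.
  rewrite -[leLHS]mulrA ler_piMr ?divr_ge0// mulrC ler_pdivrMr ?ltr_wpDr//.
  by rewrite mul1r lerDr.
pose T x := (\sum_(0 <= n <oo) (c n * \1_(F n) x)%:E)%E.
have t0 n x : (0 <= (c n * \1_(F n) x)%:E)%E.
  by rewrite lee_fin mulr_ge0 ?(ltW (c0 n)).
have e1 : (\sum_(0 <= n <oo) (1 / (2 ^ n.+1)%:R)%:E <= 1%:E :> \bar R)%E.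
  exact: (epsilon_trick0 xpredT).
have T1 x : (T x <= 1)%E.
  apply: le_trans e1; apply: lee_nneseries => [n _ _|n _]; first exact: t0.
  rewrite lee_fin (le_trans _ (cle n))// ler_piMr ?(ltW (c0 n))//.
have T0 x : (0 <= T x)%E by apply: nneseries_ge0 => n _ _; exact: t0.
have Tpos x : (0 < T x)%E.
  have : setT x by []; rewrite FT => -[n _ Fnx].
  apply: (@lt_le_trans _ _ (c n)%:E); first by rewrite lte_fin.
  rewrite /T (@nneseriesD1 _ _ n)//.
  rewrite indicE mem_set// mulr1 leeDl// nneseries_ge0//.
have Tfin x : T x = (fine (T x))%:E.
  by rewrite fineK// ge0_fin_numE// (le_lt_trans (T1 x))// ltry.
have mt n : measurable_fun setT (fun x => (c n * \1_(F n) x)%:E).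
  apply/measurable_EFinP; apply: measurable_funM => //.
  by apply: measurable_indic; exact: (mF n).1.
have mT : measurable_fun setT T.
  by apply: ge0_emeasurable_sum => // n x _ _; exact: t0.
exists (fine \o T); split; first exact: measurableT_comp.
  by move=> x /=; rewrite -lte_fin -lee_fin -Tfin Tpos T1.
under eq_integral do rewrite /= -Tfin.
rewrite /T integral_nneseries//.
apply: (@le_lt_trans _ _ 1%:E); last exact: ltry.
apply: le_trans e1; apply: lee_nneseries => [n _ _|n _].
  by apply: integral_ge0 => x _; exact: t0.
under eq_integral do rewrite EFinM.
rewrite ge0_integralZl//.
- by rewrite integral_indic ?setIT//; exact: (mF n).1.
- by apply/measurable_EFinP/measurable_indic; exact: (mF n).1.
- by rewrite lee_fin ltW.
Qed.

Section image_integral.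
Import HBNNSimple.

Lemma integral_nnsfun_comp d d' (Z : measurableType d) (Y : measurableType d')
    (R : realType) (m : {measure set Z -> \bar R}) (p : Z -> Y) (q : Z -> R)
    (s : {nnsfun Y >-> R}) :
  measurable_fun setT p -> measurable_fun setT q -> (forall z, 0 <= q z) ->
  (\int[m]_z (s (p z) * q z)%:E =
   \sum_(r \in range s) r%:E * \int[m]_(z in p @^-1` (s @^-1` [set r])) (q z)%:E)%E.
Proof.
move=> mp mq q0.
have mpre A : measurable A -> measurable (p @^-1` A).
  by move=> mA; rewrite -[X in measurable X]setTI; exact: mp.
have ms r : measurable (s @^-1` [set r]) by [].
have ge0 r z : (0 <= (r * \1_(s @^-1` [set r]) (p z) * q z)%:E)%E.
  by rewrite lee_fin mulr_ge0// -lee_fin EFinM; exact: nnfun_muleindic_ge0.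
transitivity (\int[m]_z (\sum_(r \in range s)
    (r * \1_(s @^-1` [set r]) (p z) * q z)%:E))%E.
  by apply: eq_integral => z _; rewrite fsumEFin// (fimfunE s (p z)) mulr_fsuml.
rewrite ge0_integral_fsum//; last first.
  move=> r; apply/measurable_EFinP; apply: measurable_funM => //.
  apply: measurable_funM => //; apply: measurableT_comp => //.
apply: eq_fsbigr => r; rewrite inE => -[y _ <-].
rewrite [in RHS]integral_mkcond -ge0_integralZl//.
- apply: eq_integral => z _; rewrite patchE indicE.
  rewrite -mulrA EFinM; congr (_ * _)%E.
  have -> : (z \in p @^-1` (s @^-1` [set s y])) = (p z \in s @^-1` [set s y]).
    by apply/idP/idP; rewrite !inE.
  by case: (p z \in _); rewrite ?mul1r ?mul0r.
- apply/(measurable_restrictT _ (mpre _ (ms _))).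
  by apply: measurable_funTS; exact/measurable_EFinP.
- by move=> z _; rewrite patchE; case: ifP => // _; rewrite lee_fin.
- by rewrite lee_fin.
Qed.

(** Equality on the sets psi^-1(A) is the case of an indicator K; simple
    functions and monotone limits give the rest. *)
Lemma ge0_integral_transfer d d' (X : measurableType d) (Y : measurableType d')
    (R : realType) (m1 : {measure set X -> \bar R}) (m2 : {measure set Y -> \bar R})
    (psi : X -> Y) (f : X -> R) (k : Y -> R) :
  measurable_fun setT psi ->
  measurable_fun setT f -> measurable_fun setT k ->
  (forall x, 0 <= f x) -> (forall y, 0 <= k y) ->
  (forall A, measurable A ->
     \int[m1]_(x in psi @^-1` A) (f x)%:E = \int[m2]_(y in A) (k y)%:E)%E ->
  forall K : Y -> R, measurable_fun setT K -> (forall y, 0 <= K y) ->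
  (\int[m1]_x (K (psi x) * f x)%:E = \int[m2]_y (K y * k y)%:E)%E.
Proof.
move=> mpsi mf mk f0 k0 fk K mK K0.
have mEK : measurable_fun setT (EFin \o K) by exact/measurable_EFinP.
pose s := nnsfun_approx measurableT mEK.
have scvg y : s n y @[n --> \oo] --> K y.
  have /(_ y I) := @cvg_nnsfun_approx _ _ _ _ measurableT _ mEK
    (fun y _ => K0 y : (0 <= (EFin \o K) y)%E).
  exact: fine_cvg.
have snd y : {homo (fun n => s n y) : a b / (a <= b)%N >-> a <= b}.
  by move=> a b ab; exact/lefP/nd_nnsfun_approx.
have E n : (\int[m1]_x (s n (psi x) * f x)%:E = \int[m2]_y (s n y * k y)%:E)%E.
  rewrite (integral_nnsfun_comp _ _ mpsi)//.
  rewrite (integral_nnsfun_comp _ _ (@measurable_id _ _ setT))//.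
  by apply: eq_fsbigr => r _; rewrite fk.
have mono d0 (Z : measurableType d0) (m : {measure set Z -> \bar R}) (p : Z -> Y) (q : Z -> R) :
    measurable_fun setT p -> measurable_fun setT q -> (forall z, 0 <= q z) ->
    (\int[m]_z (s n (p z) * q z)%:E)%E @[n --> \oo] -->
    (\int[m]_z (K (p z) * q z)%:E)%E.
  move=> mp mq q0.
  have -> : (\int[m]_z (K (p z) * q z)%:E =
     \int[m]_z limn (fun n => (s n (p z) * q z)%:E))%E.
    apply: eq_integral => z _; apply/esym/cvg_lim => //.
    by apply: cvg_EFin; [exact: nearW|exact: cvgMl].
  apply: cvg_monotone_convergence => //.
  - move=> n; apply/measurable_EFinP; apply: measurable_funM => //.
    exact: measurableT_comp.
  - by move=> n z _; rewrite lee_fin mulr_ge0.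
  - by move=> z _ a b ab; rewrite lee_fin ler_wpM2r// snd.
have := mono _ _ m1 _ _ mpsi mf f0; under eq_fun do rewrite E.
move=> /cvg_lim <- //.
by have /cvg_lim <- := mono _ _ m2 _ _ (@measurable_id _ _ setT) mk k0.
Qed.

End image_integral.

(** * The space L2 *)

Section L2_space.
Context d (X : measurableType d) (R : realType) (mu : {measure set X -> \bar R}).
Implicit Types (f g : X -> R[i]) (F G U V : L2 mu).

Lemma cmeasurable_real (r : X -> R) :
  measurable_fun setT r -> cmeasurable (fun x => (r x)%:C).
Proof. by move=> mr; split => //; exact: measurable_cst. Qed.

Lemma cmeasurable_comp (p : X -> X) f :
  measurable_fun setT p -> cmeasurable f -> cmeasurable (f \o p).
Proof.
by move=> mp [fr fi]; split;
  [exact: measurableT_comp fr mp|exact: measurableT_comp fi mp].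
Qed.

Lemma cmeasurable_indic f A : measurable A -> cmeasurable f ->
  cmeasurable (fun x => f x * (\1_A x)%:C).
Proof.
move=> mA mf; apply: cmeasurableM => //; apply: cmeasurable_real.
exact: measurable_indic.
Qed.

Lemma square_integrable_le f (b : X -> \bar R) : cmeasurable f ->
  measurable_fun setT b -> {ae mu, forall x, ((normc (f x) ^+ 2)%:E <= b x)%E} ->
  (\int[mu]_x b x < +oo)%E -> (forall x, 0 <= b x)%E -> square_integrable mu f.
Proof.
move=> mf mb fb boo b0; split=> //; apply: le_lt_trans boo.
apply: ae_ge0_le_integral => //.
- by move=> x _; rewrite lee_fin sqr_ge0.
- by apply/measurable_EFinP; exact: measurable_sqr_normc.
- by apply: filterS fb => x + _.
Qed.

Lemma square_integrable_dominated f g : cmeasurable f ->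
  {ae mu, forall x, normc (f x) <= normc (g x)} ->
  square_integrable mu g -> square_integrable mu f.
Proof.
move=> mf fg [mg goo]; apply: square_integrable_le goo _ => //.
- by apply/measurable_EFinP; exact: measurable_sqr_normc.
- apply: filterS fg => x fgx; rewrite lee_fin ler_pXn2r// nnegrE.
    by case: (f x) => a b; exact: sqrtr_ge0.
  by case: (g x) => a b; exact: sqrtr_ge0.
- by move=> x; rewrite lee_fin sqr_ge0.
Qed.

Lemma square_integrable_ae f g : cmeasurable f -> f = g %[ae mu] ->
  square_integrable mu g -> square_integrable mu f.
Proof.
move=> mf fg; apply: square_integrable_dominated => //.
by apply: filterS fg => x ->.
Qed.

Lemma L2_class f : square_integrable mu f ->
  exists F : L2 mu, (F : X -> R[i]) = f %[ae mu].
Proof.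
move=> sf; have fP : f \in sqint mu by exact/asboolP.
by exists (\pi_(L2 mu) (MkL2fun fP))%qT; exact: cls_repr.
Qed.

Lemma L2_0 : ((0 : L2 mu) : X -> R[i]) = cst 0 %[ae mu].
Proof.
have := L2Z 0 (0 : L2 mu); rewrite scale0r; apply: filterS => x /(_ I) -> _.
by rewrite mul0r.
Qed.

Lemma L2B F G : (F - G : L2 mu) = (fun x => F x - G x) %[ae mu].
Proof.
have := L2D F (- G); have := L2Z (-1) G; rewrite scaleN1r.
by apply: filterS2 => x /(_ I) -> /(_ I) -> _; rewrite mulN1r.
Qed.

Lemma dot_ae F G F' G' :
  {ae mu, forall x, F x * (G x)^* = F' x * (G' x)^*} -> dot F G = dot F' G'.
Proof.
move=> e; have m U V : cmeasurable (fun x => U x * (V x)^*).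
  by apply: cmeasurableM; [|apply: cmeasurable_conj]; exact: cmeasurable_L2.
by apply: ae_eq_cintegral => //; apply: filterS e => x + _.
Qed.

Lemma dot_ae0 F G : {ae mu, forall x, F x = 0 \/ G x = 0} -> dot F G = 0.
Proof.
move=> e; rewrite -(linear0l (dot : {dot (L2 mu) for Num.conj}) G); apply: dot_ae.
apply: filterS2 e L2_0 => x + /(_ I) ->.
by case=> ->; rewrite ?mul0r ?rmorph0 ?mulr0 ?mul0r.
Qed.

Lemma dot_sq F : dot F F = (Rintegral mu setT (fun x => normc (F x) ^+ 2))%:C.
Proof.
rewrite -[LHS]/(L2dot F F) /L2dot /cintegral; congr (_ +i* _).
  apply: eq_Rintegral => x _; rewrite sqr_normcE.
  by case: (F x) => a b; rewrite cReM /= mulrN opprK.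
rewrite (_ : (fun _ => _) = cst 0) ?Rintegral_cst ?mul0r//.
by apply/funext => x; case: (F x) => a b; rewrite cImM /= mulrN mulrC addNr.
Qed.

(** F 1_(B n) converges to F in L2 by dominated convergence, as soon as the sets
    B n exhaust the space up to a null set. *)
Lemma L2_closure_truncation (M : set (L2 mu)) F (B : (set X)^nat) :
  (forall n, measurable (B n)) -> nondecreasing_seq B ->
  {ae mu, forall x, exists n, B n x} ->
  (forall n G, (G : X -> R[i]) = (fun x => F x * (\1_(B n) x)%:C) %[ae mu] -> M G) ->
  closure M F.
Proof.
move=> mB ndB covB MG; apply/closureP => e e0.
have [mF Foo] := L2_square_integrable F.
have mF2 := measurable_sqr_normc mF.
pose g x := (normc (F x) ^+ 2)%:E.
pose f_ n x := (normc (F x) ^+ 2 * \1_(~` B n) x)%:E.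
have mind n : measurable_fun setT (\1_(~` B n) : X -> R).
  by apply: measurable_indic; exact: measurableC.
have ind01 n x : 0 <= (\1_(~` B n) x : R) <= 1.
  by rewrite indicE; case: (_ \in _); rewrite ler01 lexx.
have ig : mu.-integrable setT g.
  apply/integrableP; split; first exact/measurable_EFinP.
  by under eq_integral do rewrite gee0_abs ?lee_fin ?sqr_ge0//.
have mf_ n : measurable_fun setT (f_ n).
  by apply/measurable_EFinP; exact: measurable_funM.
have f_0 : {ae mu, forall x, setT x -> f_ ^~ x @ \oo --> cst 0%E x}.
  apply: filterS covB => x [n Bn] _; apply: cvg_near_cst.
  exists n => // m /= nm; rewrite /f_ indicE memNset ?mulr0// => /=; apply.
  by move/subsetPset : (ndB _ _ nm); apply.
have f_g : {ae mu, forall x n, setT x -> (`|f_ n x| <= g x)%E}.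
  apply: aeW => x n _; have /andP[i0 i1] := ind01 n x.
  by rewrite /f_ gee0_abs lee_fin ?(mulr_ge0 (sqr_ge0 _) i0)// ler_piMr ?sqr_ge0.
have [_ _] := dominated_convergence measurableT mf_ (measurable_cst _) f_0 ig f_g.
rewrite integral0 => cv.
(* A positive complex number is real. *)
have [e1 eE] : 0 < cRe e /\ e = (cRe e)%:C.
  by move: e0; case: (e) => a b; rewrite ltcE /= => /andP[/eqP -> ].
have : \forall n \near \oo, (\int[mu]_x f_ n x < (cRe e ^+ 2)%:E)%E.
  exact: cv (@nbhs_open_ereal_lt R 0 (fun=> cRe e ^+ 2) (exprn_gt0 2 e1)).
case=> N _ /(_ N (leqnn N)) /= HN.
have [G GE] : exists G : L2 mu, (G : X -> R[i]) = (fun x => F x * (\1_(B N) x)%:C) %[ae mu].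
  apply: L2_class; apply: (@square_integrable_dominated _ F).
  - exact: cmeasurable_indic.
  - apply: aeW => x; rewrite indicE; case: (_ \in _); first by rewrite mulr1.
    rewrite mulr0 Normc.normc0.
    by case: (F x) => a b; exact: sqrtr_ge0.
  - exact: L2_square_integrable.
exists G; first exact: MG GE.
rewrite -(@ltr_pXn2r _ 2)// ?nnegrE ?(ltW e0)// -dot_norm dot_sq [X in _ < X ^+ 2]eE.
rewrite -rmorphXn/= ltcR -lte_fin; apply: le_lt_trans HN.
rewrite /Rintegral fineK; last first.
  rewrite ge0_fin_numE; first by have [] := L2_square_integrable (F - G).
  by apply: integral_ge0 => x _; rewrite lee_fin sqr_ge0.
rewrite le_eqVlt; apply/orP; left; apply/eqP/ae_eq_integral => //.
- by apply/measurable_EFinP; apply: measurable_sqr_normc; exact: cmeasurable_L2.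
- apply: filterS2 (L2B F G) GE => x /(_ I) -> /(_ I) -> _; rewrite /f_ !indicE in_setC.
  by case: (x \in B N); rewrite ?mulr1 ?mulr0 ?subrr ?subr0 ?Normc.normc0 ?expr0n.
Qed.

(** To check a linear property of the functions of p it suffices to consider
    nonnegative ones: the four parts of K o p are square-integrable too, being
    dominated by K o p. *)
Lemma L2_span_comp (p : X -> X) (P : L2 mu -> Prop) : measurable_fun setT p ->
  (forall a F G, P F -> P G -> P (a *: F + G)) ->
  (forall r : X -> R, measurable_fun setT r -> (forall x, 0 <= r x) ->
    forall F, (F : X -> R[i]) = (fun x => (r (p x))%:C) %[ae mu] -> P F) ->
  forall K F, cmeasurable K -> (F : X -> R[i]) = K \o p %[ae mu] -> P F.
Proof.
move=> mp Plin Ppos K F mK FK.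
have part (a : X -> R) : measurable_fun setT a ->
    (forall x, `|a x| <= normc (K x)) ->
    exists G : L2 mu, (G : X -> R[i]) = (fun x => (Num.max (a (p x)) 0)%:C) %[ae mu] /\ P G.
  move=> ma aK.
  have mm : measurable_fun setT (fun x => Num.max (a x) 0).
    by apply: measurable_maxr => //; exact: measurable_cst.
  have [|G GE] := @L2_class (fun x => (Num.max (a (p x)) 0)%:C).
    apply: (@square_integrable_dominated _ F).
    - by apply: cmeasurable_real; exact: measurableT_comp mm mp.
    - apply: filterS FK => x /(_ I) -> /=.
      rewrite expr0n/= addr0 sqrtr_sqr; apply: le_trans (aK _).
      by rewrite maxEle; case: ifP => _; rewrite ?normr0.
    - exact: L2_square_integrable.
  by exists G; split => //; apply: (Ppos _ mm _ _ GE) => x; rewrite le_max lexx orbT.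
have [reK imK] := mK.
have nre x : `|cRe (K x)| <= normc (K x).
  case: (K x) => a b /=; rewrite -sqrtr_sqr ler_wsqrtr// lerDl sqr_ge0//.
have nim x : `|cIm (K x)| <= normc (K x).
  case: (K x) => a b /=; rewrite -sqrtr_sqr ler_wsqrtr// lerDr sqr_ge0//.
have [F1 [E1 P1]] := part _ reK nre.
have [|x|F2 [E2 P2]] := part (\- (cRe \o K)).
- exact: measurableT_comp.
- by rewrite /= normrN.
have [F3 [E3 P3]] := part _ imK nim.
have [|x|F4 [E4 P4]] := part (\- (cIm \o K)).
- exact: measurableT_comp.
- by rewrite /= normrN.
have P0 : P 0.
  apply: (Ppos (cst 0)) => //; exact: L2_0.
have -> : F = 1 *: F1 + ((-1) *: F2 + ('i *: F3 + ((- 'i) *: F4 + 0))).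
  apply/L2_eqP; near=> x => _.
  rewrite (near (L2D (1 *: F1) ((-1) *: F2 + ('i *: F3 + ((- 'i) *: F4 + 0))) ) x)//.
  rewrite (near (L2D ((-1) *: F2) ('i *: F3 + ((- 'i) *: F4 + 0))) x)//.
  rewrite (near (L2D ('i *: F3) ((- 'i) *: F4 + 0)) x)// addr0.
  rewrite (near (L2Z 1 F1) x)// (near (L2Z (-1) F2) x)//.
  rewrite (near (L2Z 'i F3) x)// (near (L2Z (- 'i) F4) x)//.
  rewrite (near FK x)// (near E1 x)// (near E2 x)// (near E3 x)// (near E4 x)//=.
  have maxB (a : R) : a = Num.max a 0 - Num.max (- a) 0.
    by rewrite !maxEle; case: ifP; case: ifP; lra.
  case: (K (p x)) => a b; apply/eqP; rewrite eq_complex /=.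
  by apply/andP; split; apply/eqP; [rewrite {1}(maxB a)|rewrite {1}(maxB b)]; ring.
by do 4!(apply: (Plin) => //).
Unshelve. all: by end_near.
Qed.

End L2_space.

(** * The density of the image measure *)

Lemma square_integrable_indic d (X : measurableType d) (R : realType)
    (mu : {measure set X -> \bar R}) (A : set X) : measurable A ->
  (mu A < +oo)%E -> square_integrable mu (fun x => (\1_A x)%:C).
Proof.
move=> mA Aoo; split; first by apply: cmeasurable_real; exact: measurable_indic.
rewrite (_ : (\int[mu]_x _ = mu A)%E)//.
rewrite -[in RHS](setIT A) -(integral_indic mu measurableT mA).
apply: eq_integral => x _; rewrite indicE; case: (_ \in _) => /=.
  by rewrite expr0n addr0 !expr1n sqrtr1 expr1n.
by rewrite !expr0n addr0 sqrtr0 expr0n.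
Qed.

Section density.
Context (R : realType) (d : measure_display) (X : measurableType d)
  (mu : {measure set X -> \bar R}) (sfmu : sigma_finite setT mu) (phi : X -> X)
  (mphi : measurable_fun setT phi) (h : X -> \bar R)
  (hphi : is_RN_derivative mu phi h).

Let mh : measurable_fun setT h. Proof. by case: hphi. Qed.
Let h0 x : (0 <= h x)%E. Proof. by case: hphi. Qed.

Lemma measurable_preim A : measurable A -> measurable (phi @^-1` A).
Proof. by move=> mA; rewrite -[X in measurable X]setTI; exact: mphi. Qed.

(** On a set where h is infinite, u o phi can only be square-integrable if u
    vanishes there: a set of positive measure on which h is infinite and |u| is
    bounded below has a preimage of infinite measure. Indicators of sets of
    finite measure on which h is infinite are thus orthogonal to the domain of
    C_phi, which is dense. *)
Lemma RN_derivative_lty : wcomp_densely_defined mu phi (cst 1) ->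
  {ae mu, forall x, (h x < +oo)%E}.
Proof.
move=> [_ dT].
pose A := h @^-1` [set +oo%E].
have mA : measurable A by rewrite -[A]setTI; exact: mh.
have domA (u : L2 mu) : opdom (wcomp mu phi (cst 1)) u -> {ae mu, forall x, A x -> u x = 0}.
  move=> [v uv].
  have mu2 : measurable_fun setT (fun x => normc (u x) ^+ 2).
    exact/measurable_sqr_normc/cmeasurable_L2.
  pose B m := A `&` [set x | m.+1%:R^-1 <= normc (u x) ^+ 2].
  have mB m : measurable (B m).
    apply: measurableI => //; rewrite -[X in measurable X]setTI.
    exact: measurable_fun_le.
  have B0 m : mu (B m) = 0.
    have mpB : measurable (phi @^-1` (B m)) by exact: measurable_preim.
    have : (mu (phi @^-1` (B m)) < +oo)%E.
      have [mv voo] := L2_square_integrable v.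
      rewrite ltey; apply/eqP => Boo; move: voo; apply/negP; rewrite -leNgt.
      apply: (@le_trans _ _ (\int[mu]_(x in phi @^-1` (B m)) (m.+1%:R^-1)%:E)%E).
        rewrite integral_cst// [X in (_ * X)%E](_ : _ = +oo%E); last exact: Boo.
        by rewrite gt0_muley ?lexx// lte_fin invr_gt0 ltr0Sn.
      apply: (@le_trans _ _ (\int[mu]_(x in phi @^-1` (B m)) (normc (L2_fun v x) ^+ 2)%:E)%E).
        apply: ae_ge0_le_integral => //.
        - by move=> x _; rewrite lee_fin sqr_ge0.
        - by apply/measurable_funTS/measurable_EFinP; exact: measurable_sqr_normc.
        - by apply: filterS uv => x /(_ I) /= -> [_ /=]; rewrite mul1r lee_fin.
      apply: ge0_subset_integral => //.
      - by apply/measurable_EFinP; exact: measurable_sqr_normc.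
      - by move=> x _; rewrite lee_fin sqr_ge0.
    case: hphi => _ _ ->//.
    have -> : (\int[mu]_(x in B m) h x = \int[mu]_(x in B m) cst +oo x)%E.
      by apply: eq_integral => x; rewrite inE => -[Ax _].
    rewrite integral_cst//; apply: contraTeq => Bm0.
    by rewrite gt0_mulye ?ltxx// lt0e Bm0 measure_ge0.
  have : mu.-negligible (\bigcup_m B m).
    by apply: negligible_bigcup => m; exists (B m); split => //; exact: B0.
  apply: negligibleS => x /= /not_implyP[Ax ux].
  have [|k] := @ltr_add_invr R 0 (normc (u x) ^+ 2).
    rewrite lt0r sqr_ge0 andbT sqrf_eq0.
    by apply/negP => /eqP /Normc.eq0_normc.
  by rewrite add0r => /ltW ku; exists k.
have [E [ET _ mE]] := (sigma_finiteP setT mu).1 sfmu.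
have AE n : mu (A `&` E n) = 0.
  have mAE : measurable (A `&` E n) by apply: measurableI => //; exact: (mE n).1.
  have [|w wE] := @L2_class _ _ _ mu (fun x => (\1_(A `&` E n) x)%:C).
    apply: square_integrable_indic => //; apply: le_lt_trans (mE n).2.
    by apply: le_measure; rewrite ?inE//; exact: (mE n).1.
  have w0 : w = 0.
    apply: orthc_dense dT _ => u uT; apply: dot_ae0.
    apply: filterS2 wE (domA _ uT) => x /(_ I) -> xA.
    rewrite indicE; have [|/negP] := boolP (x \in A `&` E n).
      by rewrite inE => -[/xA]; right.
    by left.
  apply/negligibleP => //.
  have : {ae mu, forall x, ~ (A `&` E n) x}.
    have := @L2_0 _ _ _ mu; rewrite -w0; apply: filterS2 wE => x /(_ I) -> /(_ I) /= [] /eqP.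
    by rewrite indicE; case: (boolP (x \in _)); rewrite ?oner_eq0// notin_setE.
  by apply: negligibleS => x /=; rewrite notK.
have : mu.-negligible (\bigcup_n (A `&` E n)).
  apply: negligible_bigcup => n; apply/negligibleP; last exact: AE.
  by apply: measurableI => //; exact: (mE n).1.
apply: negligibleS => x /= /negP; rewrite -leNgt leye_eq => /eqP hx.
by have : setT x by []; rewrite ET => -[n _ En]; exists n.
Qed.

Hypothesis hfin : {ae mu, forall x, (h x < +oo)%E}.

(** As h is finite a.e., nothing is lost in replacing it by a real function; the
    value 0 that fine gives to +oo is harmless. *)
Definition rdens x := fine (h x).

Lemma rdens_ge0 x : 0 <= rdens x. Proof. exact: fine_ge0. Qed.

Lemma measurable_rdens : measurable_fun setT rdens.
Proof. exact: measurableT_comp. Qed.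

Lemma measure_preim A : measurable A ->
  mu (phi @^-1` A) = (\int[mu]_(x in A) (rdens x)%:E)%E.
Proof.
move=> mA; case: hphi => _ _ ->//; apply: ae_eq_integral => //.
- exact: measurable_funTS.
- by apply/measurable_funTS/measurable_EFinP; exact: measurable_rdens.
- by apply: filterS hfin => x hx _; rewrite fineK// ge0_fin_numE.
Qed.

Lemma integral_comp_rdens (K : X -> R) : measurable_fun setT K -> (forall x, 0 <= K x) ->
  (\int[mu]_x (K (phi x))%:E = \int[mu]_x (K x * rdens x)%:E)%E.
Proof.
move=> mK K0.
have := @ge0_integral_transfer _ _ _ _ _ mu mu phi (cst 1) rdens mphi
  (measurable_cst _) measurable_rdens (fun=> ler01) rdens_ge0 _ K mK K0.
under eq_integral do rewrite mulr1; apply.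
move=> A mA; rewrite -measure_preim//.
transitivity (\int[mu]_(x in phi @^-1` A) cst 1 x)%E; first by [].
by rewrite integral_cst ?mul1e//; exact: measurable_preim.
Qed.

Lemma cintegral_comp (z : X -> R[i]) : cmeasurable z ->
  cintegral mu setT (z \o phi) = cintegral mu setT (fun x => z x * (rdens x)%:C).
Proof.
have real (r : X -> R) : measurable_fun setT r ->
    (Rintegral mu setT (r \o phi) = Rintegral mu setT (fun x => r x * rdens x)).
  move=> mr; rewrite /Rintegral; congr fine; rewrite integralE [RHS]integralE.
  have pos (s : X -> R) : measurable_fun setT s ->
    (\int[mu]_x (EFin \o (s \o phi))^\+ x =
     \int[mu]_x (EFin \o (fun x => s x * rdens x)%R)^\+ x)%E.
    move=> ms.
    transitivity (\int[mu]_x (Num.max (s (phi x)) 0)%:E)%E.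
      by apply: eq_integral => x _; rewrite funepos.unlock EFin_max.
    rewrite (@integral_comp_rdens (fun x => Num.max (s x) 0)).
    - apply: eq_integral => x _; rewrite funepos.unlock /= maxr_pMl ?rdens_ge0// mul0r.
      by rewrite EFin_max.
    - by apply: measurable_maxr => //; exact: measurable_cst.
    - by move=> x; rewrite le_max lexx orbT.
  congr (_ - _)%E; first exact: pos.
  pose s x := - r x; transitivity (\int[mu]_x (EFin \o (s \o phi))^\+ x)%E.
    by apply: eq_integral => x _; rewrite funepos.unlock funeneg.unlock.
  rewrite pos; last exact: measurableT_comp.
  by apply: eq_integral => x _; rewrite funepos.unlock funeneg.unlock /= mulNr.
move=> [zr zi]; rewrite /cintegral; congr (_ +i* _).
  rewrite [LHS](real _ zr); apply: eq_Rintegral => x _ /=.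
  by rewrite cReM/= mulr0 subr0.
rewrite [LHS](real _ zi); apply: eq_Rintegral => x _ /=.
by rewrite cImM/= mulr0 add0r.
Qed.

(** The preimage of a set where the density vanishes is null: phi does not see
    what happens there. *)
Lemma ae_comp (P : set X) : {ae mu, forall x, rdens x != 0 -> P x} ->
  {ae mu, forall x, P (phi x)}.
Proof.
move=> [N [mN N0 PN]].
pose Z := rdens @^-1` [set 0].
have mZ : measurable Z by rewrite -[Z]setTI; exact: measurable_rdens.
have nZ : mu (phi @^-1` Z) = 0.
  rewrite measure_preim//; apply: integral0_eq => x Zx.
  by congr EFin.
have nN : mu (phi @^-1` N) = 0.
  rewrite measure_preim//; apply: null_set_integral => //.
    by apply/measurable_funTS/measurable_EFinP; exact: measurable_rdens.
have : mu.-negligible (phi @^-1` N `|` phi @^-1` Z).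
  by apply: negligibleU; apply/negligibleP => //; exact: measurable_preim.
apply: negligibleS => x /= nP.
have [Z0|Z0] := eqVneq (rdens (phi x)) 0; [by right|left].
by apply: PN => /= /(_ Z0).
Qed.

Lemma measurable_cneq (a b : X -> R[i]) : cmeasurable a -> cmeasurable b ->
  measurable [set x | a x != b x].
Proof.
move=> [ar ai] [br bi].
rewrite (_ : [set x | _] = ~` (((cRe \o a) \- (cRe \o b)) @^-1` [set 0] `&`
   ((cIm \o a) \- (cIm \o b)) @^-1` [set 0])).
  apply: measurableC; apply: measurableI; rewrite -[X in measurable X]setTI.
    by apply: (measurable_funB ar br) => //; exact: measurable_set1.
  by apply: (measurable_funB ai bi) => //; exact: measurable_set1.
apply/seteqP; split=> x /=.
  move=> /eqP ab [/subr0_eq r /subr0_eq i]; apply: ab.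
  by case: (a x) (b x) r i => ? ? [? ?] /= -> ->.
by apply: contra_notN => /eqP ->; rewrite !subrr.
Qed.

Lemma ae_comp_inv (a b : X -> R[i]) : cmeasurable a -> cmeasurable b ->
  (a \o phi = b \o phi %[ae mu]) -> {ae mu, forall x, rdens x != 0 -> a x = b x}.
Proof.
move=> ma mb ab; pose B := [set x | a x != b x].
have mB : measurable B by exact: measurable_cneq.
have : mu (phi @^-1` B) = 0.
  apply/negligibleP; first exact: measurable_preim.
  by apply: negligibleS ab => x /= /eqP h1 h2; exact/h1/h2.
rewrite measure_preim// => I0.
have mr : measurable_fun B (EFin \o rdens).
  by apply/measurable_funTS/measurable_EFinP; exact: measurable_rdens.
have [+ _] := ae_eq_integral_abs mu mB mr.
under eq_integral do rewrite gee0_abs ?lee_fin ?rdens_ge0//.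
move=> /(_ I0); apply: filterS => x Bx rx; apply/eqP/negPn/negP => /Bx [].
exact/eqP.
Qed.

(** The sets where the density is at most n have preimages of finite measure,
    once they are cut down to sets of finite measure. *)
Lemma sigma_finite_image : sigma_finite setT (pushforward mu phi).
Proof.
have [E [ET ndE mE]] := (sigma_finiteP setT mu).1 sfmu.
pose F n := E n `&` [set x | rdens x <= n%:R].
have mF n : measurable (F n).
  apply: measurableI; first exact: (mE n).1.
  rewrite -[X in measurable X]setTI.
  by apply: measurable_fun_le => //; exact: measurable_rdens.
exists F.
  apply/seteqP; split=> // x _.
  have : setT x by []. rewrite ET => -[n _ En].
  have [m rm] : exists m, rdens x <= m%:R.
    by exists (Num.truncn (rdens x)).+1; exact/ltW/truncnS_gt.
  exists (maxn n m) => //; split.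
    by move: En; apply/subsetPset/ndE; exact: leq_maxl.
  by rewrite /= (le_trans rm)// ler_nat leq_maxr.
move=> n; split; first exact: mF.
rewrite /pushforward measure_preim//.
apply: (@le_lt_trans _ _ (\int[mu]_(x in F n) cst n%:R%:E x)%E).
  apply: ge0_le_integral => //.
  - by move=> x _; rewrite lee_fin rdens_ge0.
  - by apply/measurable_funTS/measurable_EFinP; exact: measurable_rdens.
  - by move=> x [_ /=]; rewrite lee_fin.
rewrite integral_cst//; apply: lte_mul_pinfty => //.
apply: le_lt_trans (mE n).2; apply: le_measure; rewrite ?inE//; last by move=> x [].
exact: (mE n).1.
Qed.

Lemma comp_weight : exists t : X -> R, [/\ measurable_fun setT t,
  forall x, 0 < t x <= 1, (\int[mu]_x (t x)%:E < +oo)%E &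
  (\int[mu]_x (t (phi x))%:E < +oo)%E].
Proof.
have [t1 [mt1 t1P t1oo]] := sigma_finite_weight sfmu.
have [t2 [mt2 t2P t2oo]] := sigma_finite_weight sigma_finite_image.
have t0 x : 0 < t1 x * t2 x.
  by case/andP: (t1P x) (t2P x) => [? _] /andP[? _]; rewrite mulr_gt0.
have le1 x : t1 x * t2 x <= t1 x.
  by case/andP: (t1P x) (t2P x) => [? _] /andP[_ ?]; rewrite ler_piMr// ltW.
have le2 x : t1 x * t2 x <= t2 x.
  by case/andP: (t1P x) (t2P x) => [_ ?] /andP[? _]; rewrite ler_piMl// ltW.
have mt : measurable_fun setT (fun x => t1 x * t2 x) by exact: measurable_funM.
exists (fun x => t1 x * t2 x); split => //.
- move=> x; rewrite t0 (le_trans (le1 x))//; by case/andP: (t1P x).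
- apply: le_lt_trans t1oo; apply: ge0_le_integral => //.
  + by move=> x _; rewrite lee_fin ltW.
  + exact/measurable_EFinP.
  + exact/measurable_EFinP.
  + by move=> x _; rewrite lee_fin.
- apply: le_lt_trans t2oo; rewrite [leRHS]ge0_integral_pushforward//; last 2 first.
  + exact/measurable_EFinP.
  + by move=> x _; rewrite lee_fin ltW//; case/andP: (t2P x).
  rewrite preimage_setT; apply: ge0_le_integral => //.
  + by move=> x _; rewrite lee_fin ltW.
  + by apply/measurable_EFinP; exact: (measurableT_comp mt mphi).
  + by apply/measurable_EFinP; exact: (measurableT_comp mt2 mphi).
  + by move=> x _; rewrite lee_fin.
Qed.

End density.

(** * Orthogonal projection onto the functions of phi *)

(** Restates the Radon-Nikodym theorem for measures that carry finiteness as a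
    hypothesis instead of in their type, with a real derivative. *)
Lemma Radon_Nikodym_real d (X : measurableType d) (R : realType)
    (m e : {measure set X -> \bar R}) :
  sigma_finite setT m -> (e setT < +oo)%E -> e `<< m ->
  exists k : X -> R, [/\ measurable_fun setT k, forall x, 0 <= k x &
    forall A, measurable A -> e A = (\int[m]_(x in A) (k x)%:E)%E].
Proof.
move=> sfm eoo em.
have efin : fin_num_fun e.
  move=> A mA; rewrite ge0_fin_numE//; apply: le_lt_trans eoo.
  by apply: le_measure; rewrite ?inE.
pose m' : {sigma_finite_measure set X -> \bar R} :=
  HB.pack_for (SigmaFiniteMeasure.type X R) (Measure.sort m)
    (isSFinite.Build _ _ _ _ (sfinite_measure_sigma_finite sfm))
    (isSigmaFinite.Build _ _ _ _ sfm).
have sfe : sigma_finite setT e.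
  by apply: fin_num_fun_sigma_finite => //; rewrite measure0.
pose e' : {finite_measure set X -> \bar R} :=
  HB.pack_for (FiniteMeasure.type X R) (Measure.sort e)
    (isFinite.Build _ _ _ _ efin)
    (isSFinite.Build _ _ _ _ (sfinite_measure_sigma_finite sfe))
    (isSigmaFinite.Build _ _ _ _ sfe).
have em' : e' `<< m' by exact: em.
pose k := Radon_Nikodym_SigmaFinite.f e' m'.
have kfin x : k x \is a fin_num := Radon_Nikodym_SigmaFinite.f_fin_num em' x.
have k0 x : (0 <= k x)%E := Radon_Nikodym_SigmaFinite.f_ge0 em' x.
exists (fine \o k); split.
- apply: measurableT_comp => //.
  exact: measurable_int (Radon_Nikodym_SigmaFinite.f_integrable em').
- by move=> x; exact: fine_ge0.
- move=> A mA; have := Radon_Nikodym_SigmaFinite.f_integral em' mA.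
  rewrite -[X in X = _]/(e A) => ->; apply: eq_integral => x _ /=.
  by rewrite fineK//; exact: kfin.
Qed.

Lemma measurable_inv_ge0 d (X : measurableType d) (R : realType) (f : X -> R) :
  measurable_fun setT f -> (forall x, 0 <= f x) -> measurable_fun setT (fun x => (f x)^-1).
Proof.
move=> mf f0; under eq_fun do rewrite -powR_inv1//.
by apply: (measurableT_comp (measurable_powR _)).
Qed.

Section projection.
Context (R : realType) (d : measure_display) (X : measurableType d)
  (mu : {measure set X -> \bar R}) (phi : X -> X)
  (mphi : measurable_fun setT phi)
  (sfnu : sigma_finite setT (pushforward mu phi)).

Let sqint_real (f : X -> R) : measurable_fun setT f ->
  (\int[mu]_x (f x ^+ 2)%:E < +oo)%E -> square_integrable mu (fun x => (f x)%:C).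
Proof.
move=> mf foo; split; first exact: cmeasurable_real.
under eq_integral do rewrite sqr_normcE/= expr0n addr0.
exact: foo.
Qed.

(** The function g is the conditional expectation of f, read on the target of
    phi. The measure f mu need not be finite, whereas f (t o phi) is integrable
    for a weight t of the image measure; so the Radon-Nikodym theorem applies to
    the latter and its derivative k is divided by t. Conditional expectation
    does not increase the L2 norm: if g_n is a truncation of g, then
    int (g_n o phi)^2 = int (g_n o phi) f <= (int (g_n o phi)^2 + int f^2) / 2. *)
Lemma ge0_condexp (f : X -> R) : measurable_fun setT f -> (forall x, 0 <= f x) ->
  (\int[mu]_x (f x ^+ 2)%:E < +oo)%E ->
  exists g : X -> R, [/\ measurable_fun setT g, forall x, 0 <= g x,
    (\int[mu]_x (g (phi x) ^+ 2)%:E < +oo)%E &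
    forall K : X -> R, measurable_fun setT K -> (forall x, 0 <= K x) ->
    (\int[mu]_x (K (phi x) * f x)%:E = \int[mu]_x (K (phi x) * g (phi x))%:E)%E].
Proof.
move=> mf f0 foo.
have [t [mt tP too]] := sigma_finite_weight (m := pushforward mu phi) sfnu.
have t0 x : 0 < t x by case/andP: (tP x).
have t1 x : t x <= 1 by case/andP: (tP x).
have mtphi : measurable_fun setT (t \o phi) by exact: measurableT_comp.
have {}too : (\int[mu]_x (t (phi x))%:E < +oo)%E.
  move: too; rewrite ge0_integral_pushforward//.
  - exact/measurable_EFinP.
  - by move=> x _; rewrite lee_fin ltW.
pose ft x := t (phi x) * f x.
have mft : measurable_fun setT ft by exact: measurable_funM.
have ft0 x : (0 <= (ft x)%:E)%E by rewrite lee_fin mulr_ge0// ltW.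
have ftoo : (\int[mu]_x (ft x)%:E < +oo)%E.
  apply: (@le_lt_trans _ _ (\int[mu]_x ((f x ^+ 2)%:E + (t (phi x))%:E))%E).
    apply: ge0_le_integral => //.
    - exact/measurable_EFinP.
    - by apply/measurable_EFinP/measurable_funD => //; exact: measurable_funX.
    - move=> x _; rewrite -EFinD lee_fin /ft.
      have := sqr_ge0 (f x - t (phi x)); have := t0 (phi x); have := t1 (phi x).
      by have := f0 x; nra.
  rewrite ge0_integralD//.
  - exact: lte_add_pinfty.
  - by move=> x _; rewrite lee_fin sqr_ge0.
  - by apply/measurable_EFinP; exact: measurable_funX.
  - by move=> x _; rewrite lee_fin ltW.
  - exact/measurable_EFinP.
have [k [mk k0 kE]] : exists k : X -> R, [/\ measurable_fun setT k, forall x, 0 <= k x &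
    forall A, measurable A -> (\int[mu]_(x in phi @^-1` A) (ft x)%:E =
                               \int[pushforward mu phi]_(x in A) (k x)%:E)%E].
  pose den : set X -> \bar R := fun A => (\int[mu]_(x in A) (ft x)%:E)%E.
  have den0 : den set0 = 0%E by exact: integral_set0.
  have den_ge0 A : (0 <= den A)%E by exact: integral_ge0.
  have den_sa : semi_sigma_additive den.
    apply: semi_sigma_additive_nng_induced => //; exact/measurable_EFinP.
  pose m : {measure set X -> \bar R} :=
    HB.pack den (isMeasure.Build _ _ _ den den0 den_ge0 den_sa).
  apply: (@Radon_Nikodym_real _ _ _ (pushforward mu phi) (pushforward m phi)) => //.
  apply/null_content_dominatesP => A mA A0.
  apply: null_set_integral => //.
    by rewrite -[X in measurable X]setTI; exact: mphi.
  by apply/measurable_funTS/measurable_EFinP.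
pose g x := k x / t x.
have mg : measurable_fun setT g.
  by apply: measurable_funM => //; apply: measurable_inv_ge0 => // x; exact: ltW.
have g0 x : 0 <= g x by rewrite divr_ge0// ltW.
have gK (K : X -> R) : measurable_fun setT K -> (forall x, 0 <= K x) ->
    (\int[mu]_x (K (phi x) * f x)%:E = \int[mu]_x (K (phi x) * g (phi x))%:E)%E.
  move=> mK K0; have mt' : measurable_fun setT (fun x => K x / t x).
    by apply: measurable_funM => //; apply: measurable_inv_ge0 => // x; exact: ltW.
  have Kt0 x : 0 <= K x / t x by rewrite divr_ge0// ltW.
  transitivity (\int[mu]_x (K (phi x) / t (phi x) * ft x)%:E)%E.
    by apply: eq_integral => x _; rewrite /ft mulrA divfK ?gt_eqF.
  rewrite (ge0_integral_transfer mphi mft mk _ k0 kE mt' Kt0)//.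
  rewrite [LHS]ge0_integral_pushforward//.
  - by apply: eq_integral => x _ /=; congr EFin; rewrite /g; ring.
  - by apply/measurable_EFinP; exact: measurable_funM.
  - by move=> x _; rewrite lee_fin; apply: mulr_ge0.
exists g; split => //.
(* On the preimage of A n, g o phi is square-integrable by the choice of t; the
   bound by f in [bound] does not depend on n. *)
pose A n := [set x | g x ^+ 2 <= n%:R * t x].
have mA n : measurable (A n).
  rewrite -[A n]setTI.
  by apply: measurable_fun_le => //; [exact: measurable_funX|exact: measurable_funM].
have mpA n : measurable (phi @^-1` A n).
  by rewrite -[X in measurable X]setTI; exact: mphi.
have mgphi : measurable_fun setT (fun x => (g (phi x) ^+ 2)%:E).
  by apply/measurable_EFinP/measurable_funX; exact: measurableT_comp mg mphi.
have bound n : (\int[mu]_(x in phi @^-1` A n) (g (phi x) ^+ 2)%:E <=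
    \int[mu]_x (f x ^+ 2)%:E)%E.
  pose gn x := g x * \1_(A n) x.
  have mgn : measurable_fun setT gn by apply: measurable_funM => //; exact: measurable_indic.
  have gn0 x : 0 <= gn x by rewrite mulr_ge0.
  have mgn2 : measurable_fun setT (fun x => (gn (phi x) ^+ 2)%:E).
    by apply/measurable_EFinP/measurable_funX; exact: measurableT_comp mgn mphi.
  have -> : (\int[mu]_(x in phi @^-1` A n) (g (phi x) ^+ 2)%:E =
      \int[mu]_x (gn (phi x) ^+ 2)%:E)%E.
    rewrite integral_mkcond; apply: eq_integral => x _.
    rewrite patchE /gn indicE.
    have -> : (x \in phi @^-1` A n) = (phi x \in A n) by apply/idP/idP; rewrite !inE.
    by case: ifP; rewrite ?mulr1 ?mulr0 ?expr0n.
  have fin : (\int[mu]_x (gn (phi x) ^+ 2)%:E < +oo)%E.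
    apply: (@le_lt_trans _ _ (\int[mu]_x (n%:R%:E * (t (phi x))%:E))%E).
      apply: ge0_le_integral => //.
      - by move=> x _; rewrite lee_fin sqr_ge0.
      - by apply/measurable_EFinP/measurable_funM.
      - move=> x _; rewrite -EFinM lee_fin /gn indicE.
        have [|_] := boolP (phi x \in A n); first by rewrite inE mulr1.
        by rewrite mulr0 expr0n mulr_ge0// ltW.
    rewrite ge0_integralZl//.
    + by apply: lte_mul_pinfty => //; rewrite lee_fin.
    + exact/measurable_EFinP.
    + by move=> x _; rewrite lee_fin ltW.
  set I := (\int[mu]_x (gn (phi x) ^+ 2)%:E)%E in fin *.
  have I0 : (0 <= I)%E by apply: integral_ge0 => x _; rewrite lee_fin sqr_ge0.
  have fI : (\int[mu]_x (gn (phi x) * f x)%:E = I)%E.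
    rewrite gK//; apply: eq_integral => x _; rewrite /gn indicE.
    by case: (_ \in _); rewrite ?mulr1 ?mulr0 ?mul0r ?expr0n.
  have mgnf : measurable_fun setT (fun x => (gn (phi x) * f x)%:E).
    by apply/measurable_EFinP/measurable_funM => //; exact: measurableT_comp mgn mphi.
  have mf2 : measurable_fun setT (fun x => (f x ^+ 2)%:E).
    by apply/measurable_EFinP; exact: measurable_funX.
  rewrite -(@leeD2lE _ I) ?ge0_fin_numE//.
  rewrite -{1 2}fI /I -!ge0_integralD//.
  - apply: ge0_le_integral => //.
    + by move=> x _; rewrite -EFinD lee_fin; apply: addr_ge0; apply: mulr_ge0.
    + by apply: (emeasurable_funD mgnf mgnf).
    + by apply: (emeasurable_funD mgn2 mf2).
    + move=> x _; rewrite -!EFinD lee_fin.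
      by have := sqr_ge0 (gn (phi x) - f x); nra.
  - by move=> x _; rewrite lee_fin sqr_ge0.
  - by move=> x _; rewrite lee_fin sqr_ge0.
  - by move=> x _; rewrite lee_fin; apply: mulr_ge0.
  - by move=> x _; rewrite lee_fin; apply: mulr_ge0.
have cover : \bigcup_n (phi @^-1` A n) = setT.
  apply/seteqP; split=> // x _.
  exists (Num.truncn (g (phi x) ^+ 2 / t (phi x))).+1 => //=.
  by rewrite /preimage /A /= -ler_pdivrMr//; exact/ltW/truncnS_gt.
apply: le_lt_trans foo; rewrite -[in leLHS]cover.
have ndA : nondecreasing_seq (fun n => phi @^-1` A n).
  move=> m n mn; apply/subsetPset => x /= /le_trans; apply.
  by rewrite ler_wpM2r ?ler_nat// ltW.
have cv := @ge0_nondecreasing_set_cvg_integral _ _ _ _ (fun x => (g (phi x) ^+ 2)%:E) mu ndA mpA.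
have {}cv := cv (fun n => measurable_funTS mgphi) (fun n x _ => sqr_ge0 (g (phi x))).
rewrite -(cvg_lim _ cv)//; apply: lime_le; first by apply/cvg_ex; eexists; exact: cv.
by apply: nearW => n; exact: bound.
Qed.

Let dot_real (F V : L2 mu) (a b : X -> R) : measurable_fun setT a -> measurable_fun setT b ->
  (F : X -> R[i]) = (fun x => (a x)%:C) %[ae mu] ->
  (V : X -> R[i]) = (fun x => (b x)%:C) %[ae mu] ->
  dot F V = (fine (\int[mu]_x (b x * a x)%:E))%:C.
Proof.
move=> ma mb Fa Vb.
transitivity (cintegral mu setT (fun x => (b x * a x)%:C)).
  apply: ae_eq_cintegral => //.
  - by apply: cmeasurableM; [|apply: cmeasurable_conj]; exact: cmeasurable_L2.
  - by apply: cmeasurable_real; exact: measurable_funM.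
  - apply: filterS2 Fa Vb => x /(_ I) -> /(_ I) -> _.
    by rewrite rmorphM/= mulrC; congr (_ * _); exact: conjc_real.
rewrite /cintegral; congr (_ +i* _).
by rewrite Rintegral_cst ?mul0r.
Qed.

(** Bilinearity reduces the claim, first in F and then in V, to nonnegative
    functions. *)
Lemma L2_projection (F : L2 mu) : exists g (G : L2 mu),
  [/\ cmeasurable g, (G : X -> R[i]) = g \o phi %[ae mu] &
   forall K (V : L2 mu), cmeasurable K -> (V : X -> R[i]) = K \o phi %[ae mu] ->
     dot (F - G) V = 0].
Proof.
apply: (@L2_span_comp _ _ _ mu id (fun F : L2 mu => exists g (G : L2 mu),
  [/\ cmeasurable g, (G : X -> R[i]) = g \o phi %[ae mu] &
   forall K (V : L2 mu), cmeasurable K -> (V : X -> R[i]) = K \o phi %[ae mu] ->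
     dot (F - G) V = 0]) _ _ _ (F : X -> R[i])) => //.
- move=> a F1 F2 [g1 [G1 [mg1 G1E o1]]] [g2 [G2 [mg2 G2E o2]]].
  exists (fun x => a * g1 x + g2 x), (a *: G1 + G2); split.
  + apply: cmeasurableD => //; apply: cmeasurableM => //.
    by split; exact: measurable_cst.
  + near=> x => _; rewrite (near (L2D (a *: G1) G2) x)// (near (L2Z a G1) x)//.
    by rewrite (near G1E x)// (near G2E x).
  + move=> K V mK VK.
    rewrite (_ : a *: F1 + F2 - (a *: G1 + G2) = a *: (F1 - G1) + (F2 - G2)).
      by rewrite linearPl/= (o1 K)// (o2 K)// mulr0 addr0.
    by rewrite scalerBr opprD addrACA.
- move=> r mr r0 {}F Fr.
  have [|g [mg g0 goo gK]] := ge0_condexp mr r0.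
    have [_] := L2_square_integrable F.
    suff -> : (\int[mu]_x (normc (F x) ^+ 2)%:E = \int[mu]_x (r x ^+ 2)%:E)%E by [].
    apply: ae_eq_integral => //.
    * by apply/measurable_EFinP; apply: measurable_sqr_normc; exact: cmeasurable_L2.
    * by apply/measurable_EFinP; exact: measurable_funX.
    * by apply: filterS Fr => x /(_ I) -> _; rewrite sqr_normcE/= expr0n addr0.
  have mgphi : measurable_fun setT (g \o phi) by exact: measurableT_comp mg mphi.
  have [G GE] := L2_class (sqint_real mgphi goo).
  exists (fun x => (g x)%:C), G; split => //; first exact: cmeasurable_real.
  apply: (L2_span_comp mphi) => [a V1 V2 V1E V2E|s ms s0 V VE].
    by rewrite linearPr/= V1E V2E mulr0 addr0.
  have msphi : measurable_fun setT (s \o phi) by exact: measurableT_comp ms mphi.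
  rewrite linearBl/= (dot_real mr msphi Fr VE) (dot_real mgphi msphi GE VE).
  by rewrite /= gK// subrr.
- exact: cmeasurable_L2.
- exact: ae_eq_refl.
Unshelve. all: by end_near.
Qed.

End projection.

(** * Conditional expectation as a projection *)

Lemma integrable_ae_eq d (X : measurableType d) (R : realType)
    (mu : {measure set X -> \bar R}) (D : set X) (f g : X -> \bar R) :
  measurable D -> measurable_fun D g -> f = g %[ae mu in D] ->
  mu.-integrable D f -> mu.-integrable D g.
Proof.
move=> mD mg fg /integrableP[mf foo]; apply/integrableP; split => //.
rewrite (_ : (\int[mu]_(x in D) `|g x| = \int[mu]_(x in D) `|f x|)%E)//.
apply: ae_eq_integral => //.
- exact: measurableT_comp.
- exact: measurableT_comp.
- by apply: filterS fg => x /[apply] ->.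
Qed.

Lemma cintegral_mkcond d (X : measurableType d) (R : realType)
    (mu : {measure set X -> \bar R}) (D : set X) (f : X -> R[i]) :
  cintegral mu D f = cintegral mu setT (fun x => f x * (\1_D x)%:C).
Proof.
rewrite /cintegral; congr (_ +i* _); rewrite Rintegral_mkcond;
  apply: eq_Rintegral => x _; rewrite patchE indicE.
  by rewrite cReM /= mulr0 subr0; case: ifP; rewrite ?mulr1 ?mulr0.
by rewrite cImM /= mulr0 add0r; case: ifP; rewrite ?mulr1 ?mulr0.
Qed.

Section conditional_expectation.
Context (R : realType) (d : measure_display) (X : measurableType d)
  (mu : {measure set X -> \bar R}) (phi : X -> X)
  (mphi : measurable_fun setT phi)
  (sfnu : sigma_finite setT (pushforward mu phi)).

Let mpre := measurable_preim mphi.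

(** The subspace on which F is projected consists of all K o phi in L2(mu), K
    itself being any measurable function: it is the closure of the range of C_phi,
    for which K has to be in L2(mu) as well. *)
Definition is_projection (F : L2 mu) (g : X -> R[i]) (G : L2 mu) :=
  [/\ cmeasurable g, (G : X -> R[i]) = g \o phi %[ae mu] &
   forall K (V : L2 mu), cmeasurable K -> (V : X -> R[i]) = K \o phi %[ae mu] ->
     dot (F - G) V = 0].

(** If the preimage of A has finite measure then its indicator is a
    square-integrable function of phi, against which F and G have equal inner
    products; these are the integrals that conditional expectation compares. *)
Lemma is_projection_cond_exp F g G : is_projection F g G ->
  is_cond_exp mu phi F (g \o phi).
Proof.
move=> [mg GE FG]; split.
  have mpphi : measurable_fun [set: g_sigma_algebra_preimageType phi]
      (phi : g_sigma_algebra_preimageType phi -> X).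
    by move=> _ B mB; rewrite setTI; exists B => //; rewrite setTI.
  by case: mg => mr mi; split;
    [exact: measurableT_comp mr mpphi|exact: measurableT_comp mi mpphi].
move=> A mA Aoo.
have mgphi : cmeasurable (g \o phi) by exact: cmeasurable_comp.
have sg : square_integrable mu (g \o phi).
  apply: square_integrable_ae mgphi _ (L2_square_integrable G).
  by apply: filterS GE => x /[apply] ->.
have sA := square_integrable_indic (mpre mA) Aoo.
have [V VE] := L2_class sA.
have eD (f : X -> R[i]) x : (phi @^-1` A) x -> f x * ((\1_(phi @^-1` A) x)%:C : R[i])^* = f x.
  by move=> Ax; rewrite -[RHS]mulr1 indicE mem_set//; congr (_ * _); exact: conjc_real.
split.
  have [ir ii] := cintegrable_dot sg sA.
  split.
    have := integrableS measurableT (mpre mA) (@subsetT _ _) ir.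
    by apply: eq_integrable => [|x /set_mem Ax /=];
      [exact: mpre|rewrite (eD (g \o phi))].
  have := integrableS measurableT (mpre mA) (@subsetT _ _) ii.
  by apply: eq_integrable => [|x /set_mem Ax /=];
    [exact: mpre|rewrite (eD (g \o phi))].
have dotV (U : L2 mu) : dot U V = cintegral mu (phi @^-1` A) U.
  rewrite cintegral_mkcond; apply: ae_eq_cintegral => //.
  - by apply: cmeasurableM; [|apply: cmeasurable_conj]; exact: cmeasurable_L2.
  - by apply: cmeasurable_indic; [exact: mpre|exact: cmeasurable_L2].
  - by apply: filterS VE => x /(_ I) -> _; congr (_ * _); exact: conjc_real.
have -> : cintegral mu (phi @^-1` A) (g \o phi) = cintegral mu (phi @^-1` A) G.
  apply: ae_eq_cintegral => //; [exact: mpre|exact: cmeasurable_L2|].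
  by apply: filterS GE => x + _ => /(_ I) ->.
rewrite -!dotV; apply/esym/eqP; rewrite -subr_eq0 -linearBl/=; apply/eqP.
apply: (FG (fun x => (\1_A x)%:C)) => //.
exact/cmeasurable_real/measurable_indic.
Qed.

(** On a set A of finite image measure, integrals over the preimages of the
    subsets of A are integrals over these subsets for the image measure, so that
    they determine the integrand; finally such sets A cover the space. *)
Let real_unique (a b : X -> R) : measurable_fun setT a -> measurable_fun setT b ->
  (forall A, measurable A -> (mu (phi @^-1` A) < +oo)%E ->
    [/\ mu.-integrable (phi @^-1` A) (EFin \o (a \o phi)),
        mu.-integrable (phi @^-1` A) (EFin \o (b \o phi)) &
        Rintegral mu (phi @^-1` A) (a \o phi) = Rintegral mu (phi @^-1` A) (b \o phi)]) ->
  {ae mu, forall x, a (phi x) = b (phi x)}.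
Proof.
move=> ma mb ab.
have [E [ET _ mE]] := (sigma_finiteP setT (pushforward mu phi)).1 sfnu.
have abE n : ae_eq (pushforward mu phi) (E n) (EFin \o a) (EFin \o b).
  apply: integral_ae_eq.
  - exact: (mE n).1.
  - have [ia _ _] := ab _ (mE n).1 (mE n).2.
    by apply: integrable_pushforward => //; [exact/measurable_EFinP|exact: (mE n).1].
  - exact/measurable_funTS/measurable_EFinP.
  - move=> D DE mD; have Doo : (mu (phi @^-1` D) < +oo)%E.
      apply: le_lt_trans (mE n).2; apply: le_measure; rewrite ?inE.
      - exact: mpre.
      - exact: mpre (mE n).1.
      - by move=> x /DE.
    have [ia ib Iab] := ab _ mD Doo.
    have mEa : measurable_fun setT (EFin \o a) by exact/measurable_EFinP.
    have mEb : measurable_fun setT (EFin \o b) by exact/measurable_EFinP.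
    rewrite (integral_pushforward mphi mEa ia mD) (integral_pushforward mphi mEb ib mD).
    rewrite -[LHS]fineK ?integrable_fin_num//; last exact: mpre.
    rewrite -[RHS]fineK ?integrable_fin_num//; last exact: mpre.
    by congr EFin.
have : mu.-negligible (\bigcup_n phi @^-1` ~` [set x | E n x -> (EFin \o a) x = (EFin \o b) x]).
  apply: negligible_bigcup => n; have [N [mN N0 EN]] := abE mphi n.
  by exists (phi @^-1` N); split; [exact: mpre|exact: N0|move=> x /EN].
apply: negligibleS => x /= abx.
have : setT (phi x) by []; rewrite ET => -[n _ En].
by exists n => //= /(_ En) []; exact: abx.
Qed.

Lemma cond_exp_unique F e e' g g' : cmeasurable g -> cmeasurable g' ->
  is_cond_exp mu phi F e -> is_cond_exp mu phi F e' ->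
  e = g \o phi %[ae mu] -> e' = g' \o phi %[ae mu] ->
  {ae mu, forall x, g (phi x) = g' (phi x)}.
Proof.
move=> [gr gi] [gr' gi'] [_ eF] [_ eF'] eg eg'.
have part (part : R[i] -> R) (e0 g0 : X -> R[i]) A : measurable A ->
    measurable_fun setT (part \o g0) -> e0 = g0 \o phi %[ae mu] ->
    mu.-integrable (phi @^-1` A) (EFin \o (part \o e0)) ->
    mu.-integrable (phi @^-1` A) (EFin \o ((part \o g0) \o phi)) /\
    Rintegral mu (phi @^-1` A) ((part \o g0) \o phi) = Rintegral mu (phi @^-1` A) (part \o e0).
  move=> mA mg0 eg0 ie.
  have mgphi : measurable_fun (phi @^-1` A) (EFin \o ((part \o g0) \o phi)).
    by apply/measurable_funTS/measurable_EFinP; exact: measurableT_comp mg0 mphi.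
  have ae1 : (EFin \o (part \o e0)) = (EFin \o ((part \o g0) \o phi)) %[ae mu in phi @^-1` A].
    by apply: filterS eg0 => x /(_ I) /= ->.
  split; first exact: (integrable_ae_eq (mpre mA) mgphi ae1 ie).
  rewrite /Rintegral; congr fine; apply/esym/ae_eq_integral => //; first exact: mpre.
  exact: measurable_int ie.
have ar : {ae mu, forall x, cRe (g (phi x)) = cRe (g' (phi x))}.
  apply: (real_unique gr gr') => A mA Aoo.
  have [[ir _] eI] := eF _ mA Aoo; have [[ir' _] eI'] := eF' _ mA Aoo.
  have [i1 I1] := part _ _ _ _ mA gr eg ir; have [i2 I2] := part _ _ _ _ mA gr' eg' ir'.
  by split => //; rewrite I1 I2; move: eI; rewrite -eI' => -[].
have ai : {ae mu, forall x, cIm (g (phi x)) = cIm (g' (phi x))}.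
  apply: (real_unique gi gi') => A mA Aoo.
  have [[_ ir] eI] := eF _ mA Aoo; have [[_ ir'] eI'] := eF' _ mA Aoo.
  have [i1 I1] := part _ _ _ _ mA gi eg ir; have [i2 I2] := part _ _ _ _ mA gi' eg' ir'.
  by split => //; rewrite I1 I2; move: eI; rewrite -eI' => -[].
apply: filterS2 ar ai => x.
by case: (g _) (g' _) => ? ? [? ?] /= -> ->.
Qed.

End conditional_expectation.

(** * The reciprocal of the composition operator *)

Section reciprocal_comp.
Context (R : realType) (d : measure_display) (X : measurableType d)
  (mu : {measure set X -> \bar R}) (sfmu : sigma_finite setT mu)
  (phi : X -> X) (mphi : measurable_fun setT phi) (h : X -> \bar R)
  (hphi : is_RN_derivative mu phi h) (hfin : {ae mu, forall x, (h x < +oo)%E}).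

Let sfnu := sigma_finite_image sfmu hphi hfin.
Let aeC (a b : X -> R[i]) : {ae mu, forall x, rdens h x != 0 -> a x = b x} ->
    {ae mu, forall x, a (phi x) = b (phi x)} :=
  ae_comp mphi hphi hfin (P := [set x | a x = b x]).
Let aeCV := ae_comp_inv mphi hphi hfin.
Let T := comp_op mu phi.
Local Notation hr := (rdens h).
Local Notation proj := (@is_projection _ _ _ mu phi).

Lemma rdens_eq0 : {ae mu, forall x, hr x = 0 <-> h x = 0%E}.
Proof.
apply: filterS hfin => x hx; rewrite /rdens; split=> [|->//].
have [_ h0 _] := hphi.
by move=> hx0; rewrite -[h x]fineK ?hx0// ge0_fin_numE.
Qed.

Lemma projection_exists (F : L2 mu) : exists g (G : L2 mu), proj F g G.
Proof. by have [g [G []]] := L2_projection mphi sfnu F; exists g, G. Qed.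

(** By uniqueness of conditional expectations the projection of F is the only
    candidate, whichever version e the pullback was built from. *)
Lemma cond_exp_pullbackP (F : L2 mu) g : is_cond_exp_pullback mu phi h F g <->
  {ae mu, forall x, h x = 0%E -> g x = 0} /\ exists G, proj F g G.
Proof.
split=> [[mg g0 [e eF eg]]|[g0 [G FG]]].
  split => //; have [g' [P FP]] := projection_exists F; exists P.
  have [mg' PE Po] := FP; split => //.
  have := cond_exp_unique mphi sfnu mg mg' eF (is_projection_cond_exp mphi FP) eg
    (@ae_eq_refl _ _ _ mu setT _ _).
  by apply: filterS2 PE => x /(_ I) -> /= ->.
have [mg _ _] := FG; split => //; exists (g \o phi); last exact: ae_eq_refl.
exact: is_projection_cond_exp FG.
Qed.

Lemma comp_opP (u v : L2 mu) : T (u, v) <-> (v : X -> R[i]) = u \o phi %[ae mu].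
Proof. by split; apply: filterS => x /(_ I) /= ->; rewrite mul1r. Qed.

(** The sets where b <= n t, for a weight t that is integrable before and after
    composition with phi; cut off outside them, any f with |f|^2 <= b lies in the
    domain of C_phi. *)
Lemma truncation (b : X -> R) : measurable_fun setT b ->
  exists A : (set X)^nat, [/\ forall n, measurable (A n), nondecreasing_seq A,
    forall x, exists n, A n x &
    forall n f, cmeasurable f -> (forall x, normc (f x) ^+ 2 <= b x) ->
      square_integrable mu (fun x => f x * (\1_(A n) x)%:C) /\
      square_integrable mu (fun x => f (phi x) * (\1_(A n) (phi x))%:C)].
Proof.
move=> mb; have [t [mt tP too tphioo]] := comp_weight sfmu mphi hphi hfin.
have t0 x : 0 < t x by case/andP: (tP x).
pose A n := [set x | b x <= n%:R * t x].
have mA n : measurable (A n).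
  by rewrite -[A n]setTI; apply: measurable_fun_le => //; exact: measurable_funM.
exists A; split => //.
- move=> m n mn; apply/subsetPset => x /= /le_trans; apply.
  by rewrite ler_wpM2r ?ler_nat// ltW.
- move=> x; exists (Num.truncn (b x / t x)).+1.
  by rewrite /A /= -ler_pdivrMr//; exact/ltW/truncnS_gt.
move=> n f mf fb.
have le x : normc (f x * (\1_(A n) x)%:C) ^+ 2 <= n%:R * t x.
  rewrite indicE; have [|_] := boolP (x \in A n).
    by rewrite inE mulr1 => Anx; apply: le_trans (fb x) Anx.
  by rewrite mulr0 Normc.normc0 expr0n mulr_ge0// ltW.
have mfA := cmeasurable_indic (mA n) mf.
have nt0 x : (0 <= (n%:R * t x)%:E)%E by rewrite lee_fin mulr_ge0// ltW.
split.
  apply: (@square_integrable_le _ _ _ _ _ (fun x => (n%:R * t x)%:E)) => //.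
  - by apply/measurable_EFinP; exact: measurable_funM.
  - by apply: aeW => x; rewrite lee_fin.
  under eq_integral do rewrite EFinM; rewrite ge0_integralZl//.
  + exact: lte_mul_pinfty.
  + exact/measurable_EFinP.
  + by move=> x _; rewrite lee_fin ltW.
apply: (@square_integrable_le _ _ _ _ _ (fun x => (n%:R * t (phi x))%:E)) => //.
- exact: (cmeasurable_comp mphi mfA).
- by apply/measurable_EFinP; apply: measurable_funM => //; exact: measurableT_comp mt mphi.
- by apply: aeW => x; rewrite lee_fin.
under eq_integral do rewrite EFinM; rewrite ge0_integralZl//.
+ exact: lte_mul_pinfty.
+ by apply/measurable_EFinP; exact: measurableT_comp mt mphi.
+ by move=> x _; rewrite lee_fin ltW.
Qed.

(** The truncations of g given by [truncation] are in the domain of C_phi. *)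
Lemma closure_ran_comp (g : X -> R[i]) (G : L2 mu) : cmeasurable g ->
  (G : X -> R[i]) = g \o phi %[ae mu] -> closure (opran T) G.
Proof.
move=> mg GE.
have [A [mA ndA covA trA]] := truncation (measurable_sqr_normc mg).
apply: (@L2_closure_truncation _ _ _ _ _ _ (fun n => phi @^-1` A n)).
- by move=> n; exact: measurable_preim.
- move=> m n mn; apply/subsetPset => x; have /subsetPset mnA := ndA _ _ mn.
  exact: mnA.
- by apply: aeW => x; exact: covA.
move=> n G' G'E.
have [s1 s2] := trA n _ mg (fun x => lexx _).
have [u uE] := L2_class s1.
exists u; apply/comp_opP.
have uphi : {ae mu, forall x, u (phi x) = g (phi x) * (\1_(A n) (phi x))%:C}.
  apply: (@aeC u (fun x => g x * (\1_(A n) x)%:C)).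
  by apply: filterS uE => x + _ => /(_ I).
near=> x => _; rewrite (near G'E x)// (near GE x)//= (near uphi x)//.
Unshelve. all: by end_near.
Qed.

(** v is the projection of u on the orthogonal complement of the kernel of C_phi,
    see [opker_comp]. *)
Lemma support_part (u : L2 mu) :
  exists v : L2 mu, {ae mu, forall x, v x = if hr x == 0 then 0 else u x}.
Proof.
have mZ : measurable (hr @^-1` [set~ 0]).
  rewrite -[X in measurable X]setTI; apply: (measurable_rdens hphi) => //.
  exact: measurableC.
have [|v vE] := @L2_class _ _ _ mu (fun x => u x * (\1_(hr @^-1` [set~ 0]) x)%:C).
  apply: (@square_integrable_dominated _ _ _ _ _ u); last exact: L2_square_integrable.
    exact/cmeasurable_indic/cmeasurable_L2.
  apply: aeW => x; rewrite indicE; case: (_ \in _); first by rewrite mulr1.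
  rewrite mulr0 Normc.normc0.
  by case: (u x) => a b; exact: sqrtr_ge0.
exists v; apply: filterS vE => x /(_ I) ->; rewrite indicE.
have [hx|hx] := eqVneq (hr x) 0.
  by rewrite memNset ?mulr0// => /=; apply.
by rewrite mem_set ?mulr1//; exact/eqP.
Qed.

Definition pullback_op : set (L2 mu * L2 mu) :=
  [set p : L2 mu * L2 mu | is_cond_exp_pullback mu phi h p.1 p.2].

Lemma opker_comp (u : L2 mu) : opker T u <-> {ae mu, forall x, hr x != 0 -> u x = 0}.
Proof.
split=> [/comp_opP u0|u0].
  apply: (@aeCV u (cst 0)); first exact: cmeasurable_L2.
    by split; exact: measurable_cst.
  by apply: filterS2 u0 (L2_0 mu) => x /(_ I) <- /(_ I) ->.
apply/comp_opP; apply: filterS2 (@aeC u (cst 0) u0) (L2_0 mu) => x /= -> /(_ I) ->.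
by [].
Qed.

Lemma projection_lin a F F' g g' G G' : proj F g G -> proj F' g' G' ->
  proj (a *: F + F') (fun x => a * g x + g' x) (a *: G + G').
Proof.
move=> [mg GE o] [mg' GE' o']; split.
- apply: cmeasurableD => //; apply: cmeasurableM => //.
  by split; exact: measurable_cst.
- near=> x => _; rewrite (near (L2D (a *: G) G') x)// (near (L2Z a G) x)//.
  by rewrite (near GE x)// (near GE' x).
- move=> K V mK VK.
  rewrite (_ : a *: F + F' - (a *: G + G') = a *: (F - G) + (F' - G')).
    by rewrite linearPl/= (o K)// (o' K)// mulr0 addr0.
  by rewrite scalerBr opprD addrACA.
Unshelve. all: by end_near.
Qed.

Lemma projection_comp (u v w : L2 mu) : T (u, v) ->
  {ae mu, forall x, w x = if hr x == 0 then 0 else u x} -> proj v w v.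
Proof.
move=> /comp_opP vE wE; split; first exact: cmeasurable_L2.
  have : {ae mu, forall x, w (phi x) = u (phi x)}.
    by apply: (@aeC w u); apply: filterS wE => x -> /negPf ->.
  by apply: filterS2 vE => x /(_ I) -> /= ->.
by move=> K V _ _; rewrite subrr linear0l.
Qed.

Lemma projection_ae (F : L2 mu) g g' G : cmeasurable g' ->
  {ae mu, forall x, hr x != 0 -> g x = g' x} -> proj F g G -> proj F g' G.
Proof.
move=> mg' gg' [mg GE FG]; split => //.
by apply: filterS2 GE (aeC gg') => x /(_ I) -> /= ->.
Qed.

Lemma projection_unique (F : L2 mu) g g' G G' : proj F g G -> proj F g' G' -> G = G'.
Proof.
move=> [mg GE o] [mg' GE' o']; apply/eqP; rewrite -subr_eq0; apply/eqP/dot0_eq0.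
have mD : cmeasurable (fun x => g x + (-1) * g' x).
  apply: cmeasurableD => //; apply: cmeasurableM => //.
  by split; exact: measurable_cst.
have DE : ((G - G' : L2 mu) : X -> R[i]) = (fun x => g x + (-1) * g' x) \o phi %[ae mu].
  apply: filterS3 (L2B G G') GE GE' => x /(_ I) -> /(_ I) -> /(_ I) -> _ /=.
  by rewrite mulN1r.
have -> : dot (G - G') (G - G') = dot (F - G') (G - G') - dot (F - G) (G - G').
  by rewrite -linearBl/=; congr (dot _ _); rewrite opprB [RHS]addrC addrA subrK.
by rewrite (o _ _ mD DE) (o' _ _ mD DE) subrr.
Qed.

Lemma L2_0_comp : {ae mu, forall x, L2_fun (0 : L2 mu) (phi x) = 0}.
Proof.
apply: (@aeC (0 : L2 mu) (cst 0)).
by apply: filterS (L2_0 mu) => x + _ => /(_ I).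
Qed.

Lemma projection_orthc (F : L2 mu) g G : proj F g G -> orthc (opran T) (F - G).
Proof.
move=> [_ _ FG] v [u /comp_opP uv].
exact: (FG (L2_fun u) v (cmeasurable_L2 _) uv).
Qed.

(** G is in the closure of the range, to which F is orthogonal; thus G is
    orthogonal to itself. *)
Lemma orthc_ran_comp (F : L2 mu) g G :
  proj F g G -> orthc (opran T) F -> G = 0.
Proof.
move=> [mg GE FG] Fran; apply: dot0_eq0.
have : orthc (closure (opran T)) F by rewrite orthc_closure.
move=> /(_ G (closure_ran_comp mg GE)) FG0.
by have := FG _ _ mg GE; rewrite linearBl/= FG0 sub0r => /eqP; rewrite oppr_eq0 => /eqP.
Qed.

(** The domain is dense because, in the decomposition F = G + (F - G), it contains
    F - G and the elements of the range of C_phi, of which G is a limit. *)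
Lemma pullback_reciprocal : is_reciprocal T pullback_op.
Proof.
have SP (F G : L2 mu) : pullback_op (F, G) <->
    {ae mu, forall x, h x = 0%E -> G x = 0} /\ exists P, proj F G P by exact: cond_exp_pullbackP.
have Sker (F : L2 mu) : opker pullback_op F <-> orthc (opran T) F.
  split=> [/SP[_ [P FP]]|Fran].
    have P0 : P = 0.
      case: FP => _ PE _.
      by apply/L2_eqP; apply: filterS3 PE L2_0_comp (L2_0 mu) => x /(_ I) -> /= -> /(_ I) ->.
    by have := projection_orthc FP; rewrite P0 subr0.
  apply/SP; split; first by apply: filterS (L2_0 mu) => x /(_ I).
  have [g [G FG]] := projection_exists F; exists 0.
  have G0 := orthc_ran_comp FG Fran; case: FG => _ _; rewrite G0 => FG.
  split => //; first exact: cmeasurable_L2.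
  by apply: filterS2 L2_0_comp (L2_0 mu) => x /= -> /(_ I) ->.
have Sran (u v : L2 mu) : T (u, v) -> exists2 w, pullback_op (v, w) &
    {ae mu, forall x, L2_fun w x = if hr x == 0 then 0 else u x}.
  move=> uv; have [w wE] := support_part u; exists w => //; apply/SP; split.
    by apply: filterS2 wE rdens_eq0 => x -> [_ hx] /hx ->; rewrite eqxx.
  by exists v; exact: projection_comp uv wE.
have Slin a u v u' v' : pullback_op (u, v) -> pullback_op (u', v') ->
    pullback_op (a *: u + u', a *: v + v').
  move=> /SP[v0 [P uP]] /SP[v0' [P' uP']]; apply/SP.
  have vE : {ae mu, forall x, L2_fun (a *: v + v') x = a * v x + v' x}.
    by apply: filterS2 (L2D (a *: v) v') (L2Z a v) => x /(_ I) -> /(_ I) ->.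
  split.
    apply: filterS3 vE v0 v0' => x -> zv zv' hx.
    by rewrite zv// zv'// mulr0 addr0.
  exists (a *: P + P'); apply: projection_ae (projection_lin a uP uP').
    exact: cmeasurable_L2.
  by apply: filterS vE => x ->.
have Sfun (u v v' : L2 mu) : pullback_op (u, v) -> pullback_op (u, v') -> v = v'.
  move=> /SP[v0 [P uP]] /SP[v0' [P' uP']]; apply/L2_eqP.
  have PP := projection_unique uP uP'; rewrite -{}PP in uP'.
  case: uP uP' => _ PE _ [_ PE' _].
  have vv : {ae mu, forall x, hr x != 0 -> v x = v' x}.
    apply: aeCV; [exact: cmeasurable_L2..|].
    by apply: filterS2 PE PE' => x /(_ I) -> /(_ I).
  near=> x => _.
  have [hx|hx] := eqVneq (hr x) 0; last exact: (near vv x).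
  have hx0 : h x = 0%E by apply: (near rdens_eq0 x _).1.
  by rewrite (near v0 x)// (near v0' x).
have domS : opdom pullback_op = addset (opran T) (orthc (opran T)).
  apply/seteqP; split=> [u [v /SP[v0 [P uP]]]|u [a [b [[c ca] bran ->]]]].
    exists P, (u - P); split; last by rewrite addrC subrK.
      by exists v; apply/comp_opP; case: uP.
    exact: projection_orthc uP.
  have [w aw _] := Sran _ _ ca; have /Sker b0 := bran.
  by exists (1 *: w + 0); rewrite -[a]scale1r; exact: Slin.
split => //.
- split => //.
  by apply/Sker => w _; rewrite linear0l.
- apply/dense_closureP => F.
  have [g [G FG]] := projection_exists F; have [mg GE o] := FG.
  rewrite (_ : F = G + (F - G)); last by rewrite addrC subrK.
  apply: closure_translate (closure_ran_comp mg GE) _ => w wran.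
  rewrite domS; exists w, (F - G); split => //.
  exact: projection_orthc FG.
split.
- move=> u v /SP[_ [P uP]]; exists P.
    by apply/comp_opP; case: uP.
  have [_ PE o] := uP.
  split; first exact: closure_ran_comp (cmeasurable_L2 _) PE.
  by rewrite orthc_closure; exact: projection_orthc uP.
- move=> u v uv; have [w vw wE] := Sran _ _ uv; exists w => //; split.
    move=> n /opker_comp n0; apply: dot_ae0; apply: filterS2 wE n0 => x -> hn.
    by have [_|/hn] := eqVneq (hr x) 0; [left|right].
  move=> n nker; apply: dot_eq0C; apply: nker; apply/opker_comp.
  apply: filterS2 (L2B u w) wE => x /(_ I) -> -> /negPf ->.
  by rewrite subrr.
- by apply/seteqP; split => F /Sker.
Unshelve. all: by end_near.
Qed.

End reciprocal_comp.

(** * The reciprocal of the adjoint *)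

Section reciprocal_adjoint.
Context (R : realType) (d : measure_display) (X : measurableType d)
  (mu : {measure set X -> \bar R}) (sfmu : sigma_finite setT mu)
  (phi : X -> X) (mphi : measurable_fun setT phi) (h : X -> \bar R)
  (hphi : is_RN_derivative mu phi h) (hfin : {ae mu, forall x, (h x < +oo)%E}).

Let aeC (a b : X -> R[i]) : {ae mu, forall x, rdens h x != 0 -> a x = b x} ->
    {ae mu, forall x, a (phi x) = b (phi x)} :=
  ae_comp mphi hphi hfin (P := [set x | a x = b x]).
Let aeCV := ae_comp_inv mphi hphi hfin.
Let T := comp_op mu phi.
Local Notation hr := (rdens h).
Local Notation proj := (@is_projection _ _ _ mu phi).

Let W := wcomp mu phi (inv_weight phi h).
Let hinv x : R[i] := ((hr x)^-1)%:C.

Let cmeasurable_hr : cmeasurable (fun x => (hr x)%:C).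
Proof. exact/cmeasurable_real/(measurable_rdens hphi). Qed.

Let cmeasurable_hinv : cmeasurable hinv.
Proof.
apply: cmeasurable_real; apply: measurable_inv_ge0; first exact: (measurable_rdens hphi).
by move=> x; exact: (rdens_ge0 hphi).
Qed.

(** The conventions agree at the values 0 and +oo of h, where both sides are
    0. *)
Lemma inv_weightE : inv_weight phi h = hinv \o phi.
Proof.
apply/funext => x; rewrite /inv_weight /hinv /= /rdens; congr (_ %:C).
have [_ h0 _] := hphi; case: (h (phi x)) (h0 (phi x)) => [r r0| |] //=.
- by rewrite inver; case: eqVneq => [->|//]; rewrite invr0.
- by rewrite invr0.
Qed.

Lemma inv_weightP (u v : L2 mu) :
  W (u, v) <-> {ae mu, forall x, v x = hinv (phi x) * u (phi x)}.
Proof.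
rewrite /W inv_weightE; split; first by apply: filterS => x /(_ I).
by apply: filterS => x + _.
Qed.

Let hinvK x (z : R[i]) : hr x != 0 -> hinv x * ((hr x)%:C * z) = z.
Proof.
by move=> hx; rewrite mulrA -rmorphM/= mulVf// mul1r.
Qed.

Let hinvVK x (z : R[i]) : hr x != 0 -> (hr x)%:C * (hinv x * z) = z.
Proof.
by move=> hx; rewrite mulrA -rmorphM/= mulfV// mul1r.
Qed.

(** The change of variables int z o phi dmu = int z h dmu with z = a b^*, the
    factor h being attached to b. *)
Lemma dot_comp (U V W0 A : L2 mu) (a b : X -> R[i]) : cmeasurable a -> cmeasurable b ->
  {ae mu, forall x, U x = a (phi x)} -> {ae mu, forall x, V x = b (phi x)} ->
  {ae mu, forall x, W0 x * (A x)^* = a x * ((hr x)%:C * b x)^*} ->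
  dot U V = dot W0 A.
Proof.
move=> ma mb Ua Vb E.
have mab : cmeasurable (fun x => a x * (b x)^*).
  by apply: cmeasurableM => //; exact: cmeasurable_conj.
transitivity (cintegral mu setT ((fun x => a x * (b x)^*) \o phi)).
  apply: ae_eq_cintegral => //.
  - by apply: cmeasurableM; [|apply: cmeasurable_conj]; exact: cmeasurable_L2.
  - exact: (cmeasurable_comp mphi mab).
  - by apply: filterS2 Ua Vb => x -> ->.
rewrite (cintegral_comp mphi hphi hfin mab); apply: ae_eq_cintegral => //.
- exact: cmeasurableM.
- by apply: cmeasurableM; [|apply: cmeasurable_conj]; exact: cmeasurable_L2.
- apply: filterS E => x -> _; rewrite rmorphM/= [X in _ = _ * (X * _)]conjc_real.
  by ring.
Qed.

Lemma inv_weight_adjoint (u v w : L2 mu) : W (u, v) ->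
  {ae mu, forall x, w x = if hr x == 0 then 0 else u x} -> adjoint T (v, w).
Proof.
move=> /inv_weightP vE wE a b /comp_opP ab.
apply: (dot_comp (a := L2_fun a) (b := fun x => hinv x * u x)).
- exact: cmeasurable_L2.
- by apply: cmeasurableM => //; exact: cmeasurable_L2.
- by apply: filterS ab => x /(_ I).
- by [].
- apply: filterS wE => x ->; congr (_ * _^*).
  by case: eqVneq => [->|hx]; rewrite ?mul0r// hinvVK.
Qed.

(** For u in the domain of C_phi, <u, G> = <u o phi, F> = <u o phi, g o phi>,
    which is the integral of u times the conjugate of h g. Choosing for u the
    truncations of D = h g - G gives D = 0. *)
Lemma adjoint_comp_projection (F G : L2 mu) : adjoint T (F, G) ->
  exists g P, is_projection phi F g P /\ {ae mu, forall x, G x = (hr x)%:C * g x}.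
Proof.
move=> FG; have [g [P FP]] := projection_exists sfmu mphi hphi hfin F.
exists g, P; split => //; have [mg PE _] := FP.
pose D x := (hr x)%:C * g x + (-1) * G x.
have mhg : cmeasurable (fun x => (hr x)%:C * g x) by exact: cmeasurableM.
have mD : cmeasurable D.
  apply: cmeasurableD => //; apply: cmeasurableM; last exact: cmeasurable_L2.
  by split; exact: measurable_cst.
(* b dominates D, whose truncations have to be in the domain of C_phi, and h g,
   whose truncations have to be in L2. *)
pose b x := normc (D x) ^+ 2 + normc ((hr x)%:C * g x) ^+ 2.
have mb : measurable_fun setT b.
  by apply: measurable_funD; exact: measurable_sqr_normc.
have [A [mA _ covA trA]] := truncation sfmu mphi hphi hfin mb.
have DA n : {ae mu, forall x, D x * (\1_(A n) x)%:C = 0}.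
  have [|s1 s2] := trA n _ mD; first by move=> x; rewrite lerDl sqr_ge0.
  have [|s3 _] := trA n _ mhg; first by move=> x; rewrite lerDr sqr_ge0.
  have [a aE] := L2_class s1; have [v vE] := L2_class s2.
  have [H HE] := L2_class s3.
  have av : T (a, v).
    apply/comp_opP.
    have aphi : {ae mu, forall x, a (phi x) = D (phi x) * (\1_(A n) (phi x))%:C}.
      apply: (@aeC a (fun x => D x * (\1_(A n) x)%:C)).
      by apply: filterS aE => x + _ => /(_ I).
    by apply: filterS2 vE aphi => x /(_ I) -> /= ->.
  have vFP : dot v F = dot v P.
    apply/eqP; rewrite -subr_eq0 -linearBr/=; apply/eqP/dot_eq0C.
    by apply: (projection_orthc FP); exists a.
  have vPH : dot v P = dot a H.
    apply: (dot_comp (a := fun x => D x * (\1_(A n) x)%:C) (b := g)) => //.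
    - exact: cmeasurable_indic.
    - by apply: filterS vE => x /(_ I).
    - by apply: filterS PE => x /(_ I).
    - apply: filterS2 aE HE => x /(_ I) -> /(_ I) ->; rewrite indicE.
      by case: (x \in A n); rewrite ?mulr1// !mulr0 !mul0r.
  have aa : dot a a = dot a (H - G).
    apply: dot_ae; apply: filterS3 aE HE (L2B H G) => x /(_ I) -> /(_ I) HEx /(_ I) ->.
    rewrite HEx indicE /D; case: (x \in A n); last by rewrite !mulr0 !mul0r.
    by rewrite !mulr1 mulN1r.
  have a0 : a = 0.
    apply: dot0_eq0; rewrite aa linearBr/= -vPH -vFP (FG _ _ av).
    by rewrite subrr.
  by apply: filterS2 aE (L2_0 mu) => x /(_ I) <- /(_ I); rewrite a0 => ->.
have : {ae mu, forall x n, D x * (\1_(A n) x)%:C = 0} by exact: ae_foralln.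
apply: filterS => x D0; have [n An] := covA x; move: (D0 n).
rewrite indicE mem_set// mulr1 /D mulN1r => /eqP; rewrite subr_eq0 => /eqP.
by [].
Qed.

Lemma opker_adjoint_comp : opker (adjoint T) = orthc (opran T).
Proof.
apply/seteqP; split=> F FT.
  by move=> v [u uv]; apply: dot_eq0C; rewrite (FT _ _ uv) linear0r.
move=> u v uv; rewrite linear0r; apply: dot_eq0C; apply: FT; by exists u.
Qed.

Lemma dense_inv_weight : dense (opdom W).
Proof.
apply/dense_closureP => F.
have mf : cmeasurable (fun x => hinv x * L2_fun F x).
  by apply: cmeasurableM => //; exact: cmeasurable_L2.
have [A [mA ndA covA trA]] := truncation sfmu mphi hphi hfin (measurable_sqr_normc mf).
apply: (@L2_closure_truncation _ _ _ _ _ _ A) => //; first exact: aeW.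
move=> n G GE; have [_ s] := trA n _ mf (fun x => lexx _).
have [V VE] := L2_class s; exists V; apply/inv_weightP.
have Gphi : {ae mu, forall x, G (phi x) = L2_fun F (phi x) * (\1_(A n) (phi x))%:C}.
  apply: (@aeC G (fun x => L2_fun F x * (\1_(A n) x)%:C)).
  by apply: filterS GE => x + _ => /(_ I).
by apply: filterS2 VE Gphi => x /(_ I) -> ->; rewrite mulrA.
Qed.

(** For v in the domain of the weighted operator, the part of v on the set where
    h is not 0 is in the range of the adjoint; so the part of u on that set is
    orthogonal to a dense subspace. *)
Lemma orthc_ran_adjoint (u : L2 mu) : orthc (opran (adjoint T)) u <->
  {ae mu, forall x, hr x != 0 -> u x = 0}.
Proof.
split=> [uT|u0 G [F /adjoint_comp_projection[g [P [_ GE]]]]]; last first.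
  apply: dot_ae0; apply: filterS2 u0 GE => x hx ->.
  by have [->|/hx] := eqVneq (hr x) 0; [right; rewrite mul0r|left].
have [u1 u1E] := support_part hphi u.
have u10 : u1 = 0.
  apply: orthc_dense dense_inv_weight _ => v [w vw].
  have [v1 v1E] := support_part hphi v.
  rewrite -(uT v1); last by exists w; exact: inv_weight_adjoint vw v1E.
  apply: dot_ae; apply: filterS2 u1E v1E => x -> ->.
  by case: ifP => _; rewrite ?mul0r// ?rmorph0 ?mulr0.
by move: u1E; rewrite u10; apply: filterS2 (L2_0 mu) => x /(_ I) -> + /negPf h0; rewrite h0.
Qed.

(** By [inv_weight_adjoint] and [adjoint_comp_projection], the weighted operator
    and the adjoint invert each other up to projections. *)
Lemma inv_weight_reciprocal : is_reciprocal (adjoint T) W.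
Proof.
have Wker (u : L2 mu) : {ae mu, forall x, hr x != 0 -> u x = 0} -> W (u, 0).
  move=> u0; apply/inv_weightP.
  have := @aeC u (cst 0) u0; apply: filterS2 (L2_0 mu) => x /(_ I) -> -> /=.
  by rewrite mulr0.
have Wran (F G : L2 mu) : adjoint T (F, G) -> exists g P, is_projection phi F g P /\ W (G, P).
  move=> /adjoint_comp_projection[g [P [FP GE]]]; exists g, P; split => //.
  apply/inv_weightP; have [mg PE _] := FP.
  have : {ae mu, forall x, g (phi x) = hinv (phi x) * G (phi x)}.
    apply: (@aeC g (fun x => hinv x * G x)).
    by apply: filterS GE => x -> hx; rewrite hinvK.
  by apply: filterS2 PE => x /(_ I) ->.
have Wlin a (u v u' v' : L2 mu) : W (u, v) -> W (u', v') -> W (a *: u + u', a *: v + v').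
  move=> /inv_weightP vE /inv_weightP vE'; apply/inv_weightP.
  have e : {ae mu, forall x, L2_fun (a *: u + u') (phi x) = a * u (phi x) + u' (phi x)}.
    apply: (@aeC (L2_fun (a *: u + u')) (fun x => a * u x + u' x)).
    by apply: filterS2 (L2D (a *: u) u') (L2Z a u) => x /(_ I) -> /(_ I) ->.
  near=> x; rewrite (near (L2D (a *: v) v') x)// (near (L2Z a v) x)//.
  by rewrite (near vE x)// (near vE' x)// (near e x)//; ring.
have split1 (u v w : L2 mu) : W (u, v) ->
    {ae mu, forall x, w x = if hr x == 0 then 0 else u x} ->
    adjoint T (v, w) /\ orthc (opran (adjoint T)) (u - w).
  move=> uv wE; split; first exact: inv_weight_adjoint uv wE.
  apply/orthc_ran_adjoint.
  by apply: filterS2 (L2B u w) wE => x /(_ I) -> -> /negPf ->; rewrite subrr.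
have domW : opdom W = addset (opran (adjoint T)) (orthc (opran (adjoint T))).
  apply/seteqP; split=> [u [v uv]|u [G [b [[F FG] bran ->]]]].
    have [w wE] := support_part hphi u; have [vw uw] := split1 _ _ _ uv wE.
    by exists w, (u - w); split; [exists v| |rewrite addrC subrK].
  have [g [P [_ GP]]] := Wran _ _ FG; have /orthc_ran_adjoint/Wker b0 := bran.
  by exists (1 *: P + 0); rewrite -[G]scale1r; exact: Wlin.
split => //.
- split => //.
  + apply: Wker; apply: filterS (L2_0 mu) => x /(_ I) -> //.
  + move=> u v v' /inv_weightP vE /inv_weightP vE'; apply/L2_eqP.
    by apply: filterS2 vE vE' => x -> -> _.
- exact: dense_inv_weight.
split.
- move=> u v uv; have [w wE] := support_part hphi u; have [vw uw] := split1 _ _ _ uv wE.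
  exists w => //; split; first by apply: subset_closure; exists v.
  by rewrite orthc_closure.
- move=> F G /Wran[g [P [FP GP]]]; exists P => //; split.
    rewrite opker_adjoint_comp => N; rewrite -orthc_closure => Nran; have [mg PE _] := FP.
    apply: dot_eq0C; apply: Nran; exact: (closure_ran_comp sfmu mphi hphi hfin mg PE).
  move=> n nker; apply: dot_eq0C; apply: nker; rewrite opker_adjoint_comp.
  exact: projection_orthc FP.
- apply/seteqP; split => u.
    move=> /inv_weightP u0; apply/orthc_ran_adjoint.
    have mu0 : cmeasurable (fun x => hinv x * L2_fun u x).
      by apply: cmeasurableM => //; exact: cmeasurable_L2.
    have m0 : cmeasurable (cst 0 : X -> R[i]) by split; exact: measurable_cst.
    have e0 : (fun x => hinv x * L2_fun u x) \o phi = cst 0 \o phi %[ae mu].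
      by apply: filterS2 u0 (L2_0 mu) => x /= <- /(_ I) ->.
    apply: filterS (aeCV mu0 m0 e0) => x hu hx.
    by rewrite -[L2_fun u x](hinvVK _ hx) hu// mulr0.
  by move=> /orthc_ran_adjoint; exact: Wker.
Unshelve. all: by end_near.
Qed.

End reciprocal_adjoint.

(** * The two formulas *)

(** Preimages of null sets are null, since they are measured by integrals of h
    over null sets. *)
Lemma wcomp_well_definedT (R : realType) d (X : measurableType d)
    (mu : {measure set X -> \bar R}) (phi : X -> X) (h : X -> \bar R) w :
  measurable_fun setT phi -> is_RN_derivative mu phi h -> cmeasurable w ->
  wcomp_well_defined mu phi w.
Proof.
move=> mphi [mh _ hE] mw N N0 A mA AN.
have muA : mu A = 0%E by exact: N0.
have mphiA := measurable_preim mphi mA.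
apply: null_set_integral => //.
  by apply/measurable_funTS/measurable_EFinP; exact: measurable_sqr_normc.
by rewrite hE//; apply: null_set_integral => //; exact: measurable_funTS.
Qed.

Theorem corollary6 (R : realType) (d : measure_display) (X : measurableType d)
    (mu : {sigma_finite_measure set X -> \bar R})
    (phi : X -> X) (mphi : measurable_fun setT phi)
    (h : X -> \bar R) (hphi : is_RN_derivative mu phi h)
    (dphi : wcomp_densely_defined mu phi (cst 1)) :
  (opdom (reciprocal (comp_op mu phi)) =
     [set F : L2 mu | exists2 g : X -> R[i],
        is_cond_exp_pullback mu phi h F g & square_integrable mu g] /\
   forall F G : L2 mu, reciprocal (comp_op mu phi) (F, G) ->
     is_cond_exp_pullback mu phi h F G) /\
  (wcomp_well_defined mu phi (inv_weight phi h) /\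
   reciprocal (adjoint (comp_op mu phi)) = wcomp mu phi (inv_weight phi h)).
Proof.
pose m : {measure set X -> \bar R} := mu.
have sfm : sigma_finite setT m := sigma_finiteT mu.
have hm : is_RN_derivative m phi h := hphi.
have hfin : {ae m, forall x, (h x < +oo)%E} := RN_derivative_lty sfm mphi hm dphi.
rewrite (reciprocalE (pullback_reciprocal sfm mphi hm hfin)).
rewrite (reciprocalE (inv_weight_reciprocal sfm mphi hm hfin)).
split; [split=> [|//]|split=> [|//]].
  apply/seteqP; split=> [F [G FG]|F [g Fg sg]].
    by exists (L2_fun G) => //; exact: L2_square_integrable.
  have [G GE] := L2_class sg; exists G.
  have /(cond_exp_pullbackP sfm mphi hm hfin)[g0 [P FP]] := Fg.
  apply/(cond_exp_pullbackP sfm mphi hm hfin); split.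
    by apply: filterS2 g0 GE => x zg /(_ I) ->.
  exists P; apply: (projection_ae mphi hm hfin _ _ FP); first exact: cmeasurable_L2.
  by apply: filterS GE => x /(_ I) ->.
apply: (wcomp_well_definedT mphi hm).
rewrite (inv_weightE hm); apply: cmeasurable_comp => //.
apply: cmeasurable_real; apply: measurable_inv_ge0; first exact: (measurable_rdens hm).
by move=> x; exact: (rdens_ge0 hm).
Qed.
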